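(* Let $q\in(0,1)$, $\mu>0$, put $\mu_q=(-\log q)\mu$, and let $I_q=\int_0^\infty q^{S_t+\mu t}\,dt$. Then $I_q$ has the probability density function $$\phi_q(x)=\frac1C\sum_{j=0}^\infty\begin{cases}h_{q,j}(x), & \text{if } \dfrac{q^{j+1}}{\mu_q}<x\le\dfrac{q^j}{\mu_q},\\[2mm] 0,&\text{else},\end{cases}\qquad x>0,$$ where $$C=\sum_{j=0}^\infty\int_{q^{j+1}/\mu_q}^{q^j/\mu_q}h_{q,j}(x)\,dx>0,$$ and the functions $h_{q,j}$ satisfy the functional recurrence relation $$h_{q,0}(x)=(1-\mu_qx)^{\lambda\mathsf{P}\{Z_1\ge1\}/\mu_q-1},\qquad x\le\frac1{\mu_q},$$ and, for $j\in\{1,2,\dots\}$ and $x\le q^j/\mu_q$, $$h_{q,j}(x)=h_{q,0}(x)\Biggl((1-q^j)^{1-\lambda\mathsf{P}\{Z_1\ge1\}/\mu_q}\,h_{q,j-1}\Bigl(\frac{q^j}{\mu_q}\Bigr)-\lambda\sum_{k=1}^jq^{-k}\,\mathsf{P}\{Z_1=k\}\int_x^{q^j/\mu_q}(1-\mu_qy)^{-\lambda\mathsf{P}\{Z_1\ge1\}/\mu_q}\,h_{q,j-k}(q^{-k}y)\,dy\Biggr).$$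
   Context: An integer-valued subordinator (IVS) $S=(S_t)_{t\ge0}$ is a driftless Lévy process with nondecreasing paths, started at $0$, whose Lévy measure is supported on the positive integers. It is written in compound Poisson form $S_t=\sum_{i=1}^{N_t}Z_i$, $t\ge0$, where $N$ is a Poisson process with intensity $\lambda>0$ and $(Z_i)_{i\ge1}$ is an i.i.d. sequence of nonnegative integer-valued random variables, independent of $N$, with $\mathsf{P}\{Z_1\ge1\}>0$. *)

(* Defs.v *)
From mathcomp Require Export all_boot all_order all_algebra.
From mathcomp Require Export all_classical all_reals all_analysis.

Set Implicit Arguments.
Unset Strict Implicit.
Unset Printing Implicit Defensive.

Import Order.TTheory GRing.Theory Num.Theory.
Import numFieldNormedType.Exports.

Local Open Scope classical_set_scope.
Local Open Scope ring_scope.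

(* The sigma-algebra generated by the family (X i), i in D. *)
Definition sigma_family d d' (T : measurableType d) (E : measurableType d')
    (I : Type) (D : set I) (X : I -> T -> E) : set (set T) :=
  <<s \bigcup_(i in D) preimage_set_system setT (X i) measurable >>.

Definition indep_systems d (T : measurableType d) (R : realType)
    (P : probability T R) (F G : set (set T)) : Prop :=
  forall A B, F A -> G B -> P (A `&` B) = (P A * P B)%E.

(* Mutual independence: product rule over every finite subfamily. *)
Definition mutually_indep d d' (T : measurableType d) (E : measurableType d')
    (R : realType) (P : probability T R) (I : eqType) (X : I -> T -> E) : Prop :=
  forall (s : seq I) (B : I -> set E), uniq s ->
    (forall i, i \in s -> measurable (B i)) ->
    P (\bigcap_(i in [set` s]) (X i @^-1` B i)) =
    (\prod_(i <- s) P (X i @^-1` B i))%E.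

Definition iid d d' (T : measurableType d) (E : measurableType d')
    (R : realType) (P : probability T R) (X : nat -> T -> E) : Prop :=
  mutually_indep P X /\
  forall i (B : set E), measurable B -> P (X i @^-1` B) = P (X 0%N @^-1` B).

(* Only times t >= 0 are constrained. The (truncated) natural subtraction in
   the increments is exact since paths are nondecreasing. In the independence
   clause, finitely many times t_0 <= ... <= t_n are obtained from an infinite
   nondecreasing sequence by taking it constant from n on. *)
Record poisson_process d (T : measurableType d) (R : realType)
    (P : probability T R) (lam : R) (N : R -> T -> nat) : Prop := PoissonProcess {
  poisson_process0 : forall w, N 0 w = 0%N ;
  poisson_process_nd : forall w (s t : R), 0 <= s -> s <= t -> (N s w <= N t w)%N ;
  poisson_process_rcont : forall w (t : R), 0 <= t -> N s w @[s --> t^'+] --> N t w ;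
  poisson_process_indep : forall t : nat -> R,
    0 <= t 0%N -> {homo t : m n / (m <= n)%N >-> m <= n} ->
    mutually_indep P (fun k w => (N (t k.+1) w - N (t k) w)%N) ;
  poisson_process_incr : forall s t : R, 0 <= s -> s < t -> forall k : nat,
    P [set w | (N t w - N s w)%N = k] = (poisson_pmf (lam * (t - s)) k)%:E
}.

(* S_t = Z_1 + ... + Z_{N_t}, where Z i stands for the variable Z_{i+1}. *)
Definition compound (T R : Type) (N : R -> T -> nat) (Z : nat -> T -> nat)
    (t : R) (w : T) : nat :=
  (\sum_(i < N t w) Z i w)%N.

Definition exp_functional (R : realType) (T : Type) (q mu : R)
    (S : R -> T -> nat) (w : T) : R :=
  \int[lebesgue_measure]_(t in `[0, +oo[) (q `^ ((S t w)%:R + mu * t)).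

Definition has_density d (T : measurableType d) (R : realType)
    (P : probability T R) (X : T -> R) (f : R -> R) : Prop :=
  [/\ measurable_fun setT X, measurable_fun setT f, forall x, 0 <= f x &
    forall A, measurable A ->
      P (X @^-1` A) = (\int[lebesgue_measure]_(x in A) (f x)%:E)%E].

Section density_functions.
Context {R : realType}.
(* p k is P{Z_1 = k} and r is P{Z_1 >= 1}; muq is (- log q) mu. *)
Variables (q muq lam r : R) (p : nat -> R).
Implicit Types h : nat -> R -> R.

(* The integrand, as a function of y, in the k-th term of the recurrence. *)
Definition h_integrand h (j k : nat) (y : R) : R :=
  (1 - muq * y) `^ (- (lam * r / muq)) * h (j - k)%N (q ^- k * y).

(* Each h j matters on x <= q^j / muq only; it is unconstrained elsewhere. *)
Definition h_recurrence h : Prop :=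
  (forall x, x <= muq^-1 -> h 0%N x = (1 - muq * x) `^ (lam * r / muq - 1)) /\
  (forall (j : nat) x, (1 <= j)%N -> x <= q ^+ j / muq ->
    h j x = h 0%N x *
      ((1 - q ^+ j) `^ (1 - lam * r / muq) * h j.-1 (q ^+ j / muq)
       - lam * \sum_(1 <= k < j.+1) q ^- k * p k *
           \int[lebesgue_measure]_(y in `[x, q ^+ j / muq])
             h_integrand h j k y)).

Definition norm_terms h (j : nat) : R :=
  \int[lebesgue_measure]_(x in `[q ^+ j.+1 / muq, q ^+ j / muq]) h j x.

(* Rintegral and limn are total; this says that the integrals in h_recurrence
   and norm_const, and the series in norm_const, do converge. *)
Definition h_convergent h : Prop :=
  [/\ forall (j k : nat) x, (1 <= k <= j)%N -> x <= q ^+ j / muq ->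
        lebesgue_measure.-integrable `[x, q ^+ j / muq]
          (EFin \o h_integrand h j k),
      forall j : nat,
        lebesgue_measure.-integrable `[q ^+ j.+1 / muq, q ^+ j / muq]
          (EFin \o h j)
    & cvgn (series (norm_terms h))].

Definition norm_const h : R := limn (series (norm_terms h)).

(* At most one term is nonzero, and none is when x <= 0. *)
Definition phi h (x : R) : R :=
  (norm_const h)^-1 *
  limn (series (fun j : nat =>
    if q ^+ j.+1 / muq < x <= q ^+ j / muq then h j x else 0)).

End density_functions.

(* Main.v *)
From HB Require Import structures.
Require Import Defs.
From mathcomp Require Import measurable_realfun.
From mathcomp Require Import ring lra.

(** The exponential functional and the candidate density both live on a bounded
    interval, where a law is determined by its moments, so that it is enough to
    compare moments.

    On the probabilistic side, let psi(n) = n mu_q + lam (1 - E q^(n Z)) be the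
    [laplace_exponent], so that E q^(n (S_t + mu t)) = exp (- t psi(n)). The n-th
    power of the functional is n! times an integral over ordered times
    t_1 <= ... <= t_n; since the increments are independent and stationary, the
    expectation of the integrand is a product of exponentials, and the n-th moment
    is n! / (psi(1) ... psi(n)): this is [exp_functional_moment].

    On the analytic side, let g be the function [glued] from the pieces h_j on
    (0, 1/mu_q], and G(x) the integral of g from x to 1/mu_q. The recurrence is
    the variation-of-constants formula for the equation
      ((1 - mu_q x) g(x))' = lam (sum_k q^-k p_k g(q^-k x) - r g(x)),
    where the terms with q^-k x > 1/mu_q vanish. Integrated, it reads
      (1 - mu_q x) g(x) = lam (r G(x) - sum_k p_k G(q^-k x)),
    which is [tail_equation]. Three facts follow from this identity.
    - Positivity. The right-hand side is
      lam ((r - sum_k p_k) G(x) + sum_k p_k (G(x) - G(q^-k x))). If g > 0 to the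
      right of x, then G is decreasing there and this is positive, because r > 0;
      so g cannot reach a zero when x moves down from 1/mu_q to 0 ([glued_gt0]).
    - Finiteness of C. Near 0 the identity gives g <= K G with a constant K, so
      that G grows by a bounded factor only ([tail_glued_bounded]).
    - Moments. Multiplying by n x^(n-1) and integrating over x > 0, the moments
      M_n of g satisfy n M_(n-1) = psi(n) M_n ([moment_recursion]).
    As M_0 = C, the function g / C has the moments of the functional. Finally
    [density_of_moments] identifies the two laws: the polynomials
    (1 - (x/b)^n)^m, with m close to n (b/c)^n, converge boundedly on [0, b) to
    the indicator of x < c, so equal moments give equal distribution functions. *)

Set Implicit Arguments.
Unset Strict Implicit.
Unset Printing Implicit Defensive.

Import Order.TTheory GRing.Theory Num.Theory.
Import numFieldNormedType.Exports.

Local Open Scope classical_set_scope.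
Local Open Scope ring_scope.

(** * Integrals of functions of integer-valued variables *)

Lemma measurable_prodr d (T : measurableType d) (R : realType) (I : Type)
    (s : seq I) (D : set T) (f : I -> T -> R) :
  (forall i, measurable_fun D (f i)) ->
  measurable_fun D (fun w => \prod_(i <- s) f i w).
Proof.
move=> mf; elim: s => [|i s IH].
  by under eq_fun do rewrite big_nil; exact: measurable_cst.
by under eq_fun do rewrite big_cons; apply: measurable_funM.
Qed.

Section discrete.
Context d (T : measurableType d) (R : realType) (P : probability T R).
Local Open Scope ereal_scope.

(** An integral can be computed by conditioning on an integer-valued variable;
    this is the form in which conditioning on the counting process is used. *)
Lemma integral_nat_partition (K : T -> nat) (A : set T) (F : T -> \bar R) :
  measurable A -> (forall n, measurable (K @^-1` [set n])) ->
  measurable_fun A F -> (forall w, A w -> 0 <= F w) ->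
  \int[P]_(w in A) F w = \sum_(n <oo) \int[P]_(w in A `&` K @^-1` [set n]) F w.
Proof.
move=> mA mK mF F0.
have AE : A = \bigcup_n (A `&` K @^-1` [set n]).
  by apply/seteqP; split=> [w Aw|w [n _ []]//]; exists (K w).
rewrite {1}AE ge0_integral_bigcup//.
- by move=> n; exact: measurableI.
- by rewrite -AE.
- by move=> w [n _ [Aw _]]; exact: F0.
- by move=> i j _ _ [w [[_ <-] [_ <-]]].
Qed.

(** Randomly indexed families stay measurable because the index is discrete; a
    compound sum is the partial sums of the jumps read at a random index. *)
Lemma measurable_nat_family (X : T -> nat) (Y : nat -> T -> nat) :
  (forall n, measurable (X @^-1` [set n])) ->
  (forall i n, measurable (Y i @^-1` [set n])) ->
  forall n, measurable ((fun w => Y (X w) w) @^-1` [set n]).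
Proof.
move=> mX mY n.
have -> : (fun w => Y (X w) w) @^-1` [set n] =
    \bigcup_i (X @^-1` [set i] `&` Y i @^-1` [set n]).
  by apply/seteqP; split=> [w /= wn|w [i _ [/= <-]]//]; exists (X w).
by apply: bigcup_measurable => i _; apply: measurableI.
Qed.

Lemma nat_valued_measurable (X : T -> nat) (f : nat -> R) :
  (forall n, measurable (X @^-1` [set n])) ->
  measurable_fun setT (f \o X).
Proof.
move=> mX _ Y mY; rewrite setTI.
have -> : (f \o X) @^-1` Y = \bigcup_(n in f @^-1` Y) (X @^-1` [set n]).
  by apply/seteqP; split=> [w Yw|w [n Yn Xn]]; [exists (X w)|rewrite /= Xn].
exact: bigcup_measurable.
Qed.

Lemma integral_nat_valued (X : T -> nat) (f : nat -> R) :
  (forall n, measurable (X @^-1` [set n])) -> (forall n, 0 <= f n)%R ->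
  \int[P]_w (f (X w))%:E = \sum_(n <oo) (f n)%:E * P (X @^-1` [set n]).
Proof.
move=> mX f0; rewrite (integral_nat_partition (K := X))//; last 2 first.
- by apply/measurable_EFinP; exact: nat_valued_measurable.
- by move=> w _; rewrite lee_fin.
apply: eq_eseriesr => n _.
rewrite (eq_integral (fun w => (f n)%:E)) ?integral_cst ?setTI// => w.
by rewrite inE => /= ->.
Qed.

(** The product rule for events passes to integrals of products by peeling off
    one factor at a time and partitioning [A] by its value. Keeping an arbitrary
    event [A] makes the induction go through, and allows [A] to be an event of
    the counting process, on which the number of jumps is fixed. *)
Lemma integral_indep_prod (I : eqType) (X : I -> T -> nat) (s : seq I)
    (f : I -> nat -> R) (A : set T) :
  uniq s -> measurable A ->
  (forall i n, measurable (X i @^-1` [set n])) ->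
  (forall i n, 0 <= f i n <= 1)%R ->
  (forall B : I -> set nat, P (A `&` \bigcap_(i in [set` s]) (X i @^-1` B i)) =
     P A * \prod_(i <- s) P (X i @^-1` B i)) ->
  \int[P]_(w in A) (\prod_(i <- s) f i (X i w))%:E =
  P A * \prod_(i <- s) \int[P]_w (f i (X i w))%:E.
Proof.
move=> us mA mX f01; have f0 i n : (0 <= f i n)%R by case/andP: (f01 i n).
elim: s us A mA => [_ A mA _|i s IH /= /andP[iNs us] A mA indA].
  by under eq_integral do rewrite big_nil; rewrite integral_cst// mul1e big_nil mule1.
have mXB j (B : set nat) : measurable (X j @^-1` B).
  have -> : X j @^-1` B = \bigcup_(n in B) (X j @^-1` [set n]).
    by apply/seteqP; split=> [w Bw|w [n Bn Xn]]; [exists (X j w)|rewrite /= Xn].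
  exact: bigcup_measurable.
have capcons (B : I -> set nat) : \bigcap_(j in [set` i :: s]) (X j @^-1` B j) =
    (X i @^-1` B i) `&` \bigcap_(j in [set` s]) (X j @^-1` B j).
  apply/seteqP; split=> [w /= h|w /= [hi h] j]; first split.
  - by apply: h; rewrite /= mem_head.
  - by move=> j js; apply: h; rewrite /= in_cons js orbT.
  - by rewrite /= in_cons => /predU1P[->//|]; exact: h.
(* the factor being peeled off is moved into the event *)
have key n B : P (A `&` X i @^-1` [set n] `&` \bigcap_(j in [set` s]) (X j @^-1` B j)) =
    P A * P (X i @^-1` [set n]) * \prod_(j <- s) P (X j @^-1` B j).
  have := indA (fun j => if j == i then [set n] else B j).
  rewrite capcons eqxx setIA big_cons eqxx muleA.
  have eB j : j \in s -> (if j == i then [set n] else B j) = B j.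
    by case: eqP => // ->; rewrite (negPf iNs).
  rewrite [in X in P (_ `&` X)](_ : bigcap _ _ = \bigcap_(j in [set` s]) (X j @^-1` B j)); last first.
    by apply: eq_bigcapr => j js; rewrite eB.
  move=> ->; congr (_ * _).
  by rewrite [LHS]big_seq [RHS]big_seq; apply: eq_bigr => j js; rewrite eB.
have keyA n : P (A `&` X i @^-1` [set n]) = P A * P (X i @^-1` [set n]).
  have := key n (fun=> setT).
  rewrite (_ : bigcap _ _ = setT) ?setIT; last by apply/seteqP; split.
  move=> ->; rewrite big1 ?mule1// => j _.
  by rewrite preimage_setT probability_setT.
have mf (s' : seq I) D : measurable_fun D (fun w => (\prod_(j <- s') f j (X j w))%:E).
  apply: measurable_funTS; apply/measurable_EFinP/measurable_prodr => j.
  exact: (@nat_valued_measurable (X j)).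
rewrite (@integral_nat_partition (X i))//; last first.
  by move=> w _; rewrite lee_fin prodr_ge0.
rewrite big_cons.
rewrite integral_nat_valued//.
under eq_eseriesr => n _.
  rewrite (eq_integral (fun w => (f i n)%:E * (\prod_(j <- s) f j (X j w))%:E)); last first.
    by move=> w /[!inE] -[_ /= Xn]; rewrite big_cons Xn EFinM.
  rewrite ge0_integralZl_EFin//; [|exact: measurableI|by move=> w _; rewrite lee_fin prodr_ge0].
  rewrite IH//; [|exact: measurableI|by move=> B; rewrite key keyA].
  rewrite keyA -muleA (muleCA _ (P A)) (muleA (f i n)%:E).
  over.
have [c c0 ->] : exists2 c, (0 <= c)%R & P A = c%:E.
  by exists (fine (P A)); rewrite ?fine_ge0// fineK// fin_num_measure.
rewrite nneseriesZl => [|n _]; last first.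
  rewrite mule_ge0//; first by rewrite mule_ge0// lee_fin.
  by elim/big_rec: _ => // j x _ x0; rewrite mule_ge0// integral_ge0// => w _; rewrite lee_fin.
congr (_ * _).
have [c' ->] : exists c', \prod_(j <- s) \int[P]_w (f j (X j w))%:E = c'%:E.
  elim/big_rec: _ => [|j x _ [c' ->]]; first by exists 1%R.
  exists (fine (\int[P]_w (f j (X j w))%:E) * c')%R.
  rewrite EFinM fineK// ge0_fin_numE; last first.
    by apply: integral_ge0 => w _; rewrite lee_fin.
  apply: (@le_lt_trans _ _ (\int[P]_w (cst 1 w))); last first.
    by rewrite integral_cst// mul1e (le_lt_trans (probability_le1 _ _)) ?ltry.
  apply: ge0_le_integral => //.
  - by move=> w _; rewrite lee_fin.
  - by apply/measurable_EFinP; exact: nat_valued_measurable.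
  - by move=> w _; rewrite lee_fin; case/andP: (f01 j (X j w)).
rewrite [RHS]muleC -nneseriesZl => [|n _]; last by rewrite mule_ge0// lee_fin.
by apply: eq_eseriesr => n _; rewrite muleC.
Qed.

End discrete.

(** * Rearranging the jumps of a compound process *)

Section combinatorics.
Local Open Scope nat_scope.

(** Here [nn k] is the number of jumps up to the [k]-th of [m] increasing times.
    Jump number [j] is counted at all the times with [j < nn k], so in a product
    of powers of [q] over these times it enters with the exponent [nb_above], the
    number of times after it. That exponent is [m - k] for the jumps between the
    times [k] and [k.+1]. The sum adds booleans. *)
Definition nb_above (nn : nat -> nat) (m j : nat) : nat := \sum_(k < m) (j < nn k.+1).

Lemma prod_nb_above (R : comNzRingType) (a : nat -> R) (nn : nat -> nat) (m : nat) :
  nn 0 = 0 -> {homo nn : i j / i <= j} ->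
  (\prod_(j < nn m) a (nb_above nn m j) =
   \prod_(k < m) a (m - k)%N ^+ (nn k.+1 - nn k))%R.
Proof.
move=> nn0 hnn; elim: m a => [|m IH] a; first by rewrite nn0 !big_ord0.
rewrite [in RHS]big_ord_recr/= subSnn.
rewrite -(big_mkord xpredT (fun j => a (nb_above nn m.+1 j))).
rewrite (@big_cat_nat _ _ _ (nn m))//=; last exact: hnn.
congr (_ * _)%R.
  rewrite big_mkord (eq_bigr (fun j : 'I_(nn m) => a (nb_above nn m j).+1)).
    rewrite (IH (fun n => a n.+1)); apply: eq_bigr => k _.
    by rewrite subSn// ltnW.
  move=> j _; rewrite /nb_above big_ord_recr/= (leq_trans (ltn_ord j)) ?hnn//.
  by rewrite addn1.
rewrite big_nat_cond (eq_bigr (fun=> a 1)) => [|j /andP[/andP[nj jn] _]].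
  by rewrite -big_nat_cond prodr_const_nat.
rewrite /nb_above big_ord_recr/= jn big1// => k _.
by rewrite ltnNge (leq_trans _ nj)// hnn.
Qed.

Lemma prod_partial_sums (R : comNzRingType) (x : R) (z nn : nat -> nat) (m : nat) :
  {homo nn : i j / i <= j} ->
  (\prod_(k < m) x ^+ (\sum_(j < nn k.+1) z j) =
   \prod_(j < nn m) (x ^+ nb_above nn m j) ^+ z j)%R.
Proof.
move=> hnn.
rewrite (eq_bigr (fun k : 'I_m => \prod_(j < nn m) x ^+ ((j < nn k.+1) * z j)))%R.
  rewrite exchange_big/=; apply: eq_bigr => j _.
  by rewrite -expr_sum /nb_above -exprM big_distrl.
move=> k _; rewrite -expr_sum.
rewrite (big_ord_widen_cond (nn m) xpredT (fun j => z j)) ?hnn//=.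
by rewrite big_mkcond/=; congr (_ ^+ _)%R; apply: eq_bigr => j _; case: ifP; rewrite ?mul1n.
Qed.

End combinatorics.

Lemma poisson_pgf d (T : measurableType d) (R : realType) (P : probability T R)
    (X : T -> nat) (c x : R) : 0 < c -> 0 <= x <= 1 ->
  (forall n, measurable (X @^-1` [set n])) ->
  (forall k, P [set w | X w = k] = (poisson_pmf c k)%:E) ->
  (\int[P]_w (x ^+ X w)%:E = (expR (- c * (1 - x)))%:E)%E.
Proof.
move=> c0 /andP[x0 x1] mX PX.
rewrite integral_nat_valued => [|//|n]; last exact: exprn_ge0.
under eq_eseriesr => n _.
  rewrite [X in (_ * X)%E](_ : _ = (poisson_pmf c n)%:E); last exact: PX.
  rewrite -EFinM.
  rewrite (_ : _ * _ = expR (- c) * exp_coeff (c * x) n); last first.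
    by rewrite /poisson_pmf c0 /exp_coeff /= exprMn; ring.
  rewrite EFinM.
  over.
rewrite nneseriesZl; last first.
  by move=> n _; rewrite lee_fin exp_coeff_ge0// mulr_ge0// ltW.
rewrite (_ : (\sum_(0 <= i <oo) (exp_coeff (c * x) i)%:E)%E = (expR (c * x))%:E).
  by rewrite -EFinM -expRD; congr (expR _)%:E; ring.
rewrite expRE -EFin_lim; last first.
  rewrite /pseries/=; under eq_fun do rewrite mulrC.
  exact: is_cvg_series_exp_coeff.
apply/congr_lim/funext => n/=; rewrite /pseries/= /series/= -sumEFin//.
by apply: eq_bigr => i _; rewrite /exp_coeff/= mulrC.
Qed.

(** * Tail integrals and ordered simplices *)

Section calculus.
Context (R : realType).

Lemma is_derive_affine (a b x : R) : is_derive x (1 : R) (fun u => a + b * u) b.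
Proof.
rewrite (_ : (fun u => a + b * u) = cst a + b \*: id)//.
by apply: is_derive_eq; rewrite add0r; exact: mulr1.
Qed.

Lemma is_derive_continuous (f : R -> R) (x df : R) :
  is_derive x (1 : R) f df -> {for x, continuous f}.
Proof. by move=> [+ _] => /derivable1_diffP/differentiable_continuous. Qed.

Lemma exponential_tail (c s : R) : 0 < c ->
  (\int[lebesgue_measure]_(u in `[s, +oo[) (expR (- ((u - s) * c)))%:E = c^-1%:E)%E.
Proof.
move=> c0.
pose F (u : R) : R := - c^-1 * (expR \o (fun u => s * c + (- c) * u)) u.
have dF (x : R) : is_derive x (1 : R) F (expR (- ((x - s) * c))).
  have dE := is_derive1_comp (is_derive_expR _) (is_derive_affine (s * c) (- c) x).
  have dZ := is_deriveZ (- c^-1) dE.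
  apply: (is_derive_eq dZ); rewrite /GRing.scale/= mulrN mulNr mulrN opprK mulrCA mulVf ?gt_eqF// mulr1.
  by congr expR; ring.
have cf : continuous (fun u : R => expR (- ((u - s) * c))).
  move=> x; apply: continuous_comp; last exact: continuous_expR.
  apply: continuousN; apply: continuousM; last exact: cst_continuous.
  by apply: continuousB; [exact: id|exact: cst_continuous].
rewrite (@ge0_continuous_FTC2y _ _ F s 0).
- rewrite -EFinB sub0r /F/= (_ : s * c + - c * s = 0) ?expR0 ?mulr1 ?opprK//.
  by ring.
- by move=> x _; exact: expR_ge0.
- exact: continuous_subspaceT.
- rewrite (_ : F = fun u => (- c^-1 * expR (s * c)) * expR (- (c * u))); last first.
    by apply/funext => u; rewrite /F/= expRD (mulNr c) mulrA.
  rewrite -[X in _ --> X](mulr0 (- c^-1 * expR (s * c))).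
  apply: cvgM; first exact: cvg_cst.
  apply: (@cvg_comp _ _ _ (fun u => c * u) (fun u => expR (- u))); last exact: cvgr_expR.
  exact: gt0_cvgMry.
- by move=> x _; have [] := dF x.
- by apply: cvg_at_right_filter; exact: is_derive_continuous.
- by move=> x _; rewrite derive1E; have [_] := dF x.
Qed.

End calculus.

Section tail_integrals.
Context (R : realType).
Notation leb := (@lebesgue_measure R).
Local Open Scope ereal_scope.

Lemma tail_integralE (f : R -> \bar R) (s : R) :
  \int[leb]_(u in `[s, +oo[) f u = \int[leb]_u ((s <= u)%R%:R%:E * f u).
Proof.
rewrite integral_mkcond; apply: eq_integral => u _; rewrite patchE mem_setE in_itv/= andbT.
by case: ifP; rewrite ?mul1e ?mul0e.
Qed.

Lemma measurable_le_indic d (T : measurableType d) (f g : T -> R) :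
  measurable_fun setT f -> measurable_fun setT g ->
  measurable_fun setT (fun x => (f x <= g x)%R%:R%:E : \bar R).
Proof.
move=> mf mg; apply/measurable_EFinP.
rewrite (_ : (fun x => _) = (\1_[set x | (f x <= g x)%R] : T -> R)).
  apply: measurable_indic; rewrite -[X in measurable X]setTI.
  exact: (measurable_fun_ler mf mg).
by apply/funext => x; rewrite indicE mem_setE.
Qed.

Lemma measurable_lt_indic d (T : measurableType d) (f g : T -> R) :
  measurable_fun setT f -> measurable_fun setT g ->
  measurable_fun setT (fun x => (f x < g x)%R%:R%:E : \bar R).
Proof.
move=> mf mg; apply/measurable_EFinP.
rewrite (_ : (fun x => _) = (\1_[set x | (f x < g x)%R] : T -> R)).
  apply: measurable_indic; rewrite -[X in measurable X]setTI.
  exact: (measurable_fun_ltr mf mg).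
by apply/funext => x; rewrite indicE mem_setE.
Qed.

Lemma open_tail_integralE (f : R -> \bar R) (s : R) : measurable_fun setT f ->
  \int[leb]_(u in `[s, +oo[) f u = \int[leb]_u ((s < u)%R%:R%:E * f u).
Proof.
move=> mf; rewrite -integral_itv_obnd_cbnd; last exact: measurable_funTS.
rewrite integral_mkcond; apply: eq_integral => u _; rewrite patchE mem_setE in_itv/= andbT.
by case: ifP; rewrite ?mul1e ?mul0e.
Qed.

(** The joint measurability in the lower bound and the parameter is what lets
    the definition of [simplex_integral] be iterated on random integrands. *)
Lemma tail_integral_measurable d (T : measurableType d)
    (f : measurableTypeR R * T -> \bar R) :
  (forall x, 0 <= f x) -> measurable_fun setT f ->
  measurable_fun setT (fun x : measurableTypeR R * T =>
    \int[leb]_(u in `[x.1, +oo[) f (u, x.2)).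
Proof.
move=> f0 mf; under eq_fun do rewrite tail_integralE.
apply: (@measurable_fun_fubini_tonelli_F _ _ _ _ _ leb
  (fun z : (measurableTypeR R * T) * measurableTypeR R =>
     (z.1.1 <= z.2)%R%:R%:E * f (z.2, z.1.2))).
  2: by move=> z; rewrite mule_ge0// lee_fin.
apply: emeasurable_funM.
  by apply: measurable_le_indic => //; exact: measurableT_comp.
apply: (measurableT_comp mf); apply: measurable_fun_pair => //.
exact: measurableT_comp.
Qed.

(** A square is cut along its diagonal. One of the two triangles is taken
    open, so that the diagonal is counted once. *)
Lemma tail_integral_prod (f g : R -> \bar R) (s : R) :
  (forall x, 0 <= f x) -> (forall x, 0 <= g x) ->
  measurable_fun setT f -> measurable_fun setT g ->
  (\int[leb]_(v in `[s, +oo[) f v) * (\int[leb]_(u in `[s, +oo[) g u) =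
  \int[leb]_(u in `[s, +oo[) (g u * \int[leb]_(v in `[u, +oo[) f v) +
  \int[leb]_(v in `[s, +oo[) (f v * \int[leb]_(u in `[v, +oo[) g u).
Proof.
move=> f0 g0 mf mg.
pose F1 (z : measurableTypeR R * measurableTypeR R) :=
  (s <= z.1)%R%:R%:E * f z.1 * ((z.1 <= z.2)%R%:R%:E * g z.2).
pose F2 (z : measurableTypeR R * measurableTypeR R) :=
  (s <= z.2)%R%:R%:E * g z.2 * ((z.2 < z.1)%R%:R%:E * f z.1).
have F10 z : 0 <= F1 z by rewrite /F1 !mule_ge0// lee_fin.
have F20 z : 0 <= F2 z by rewrite /F2 !mule_ge0// lee_fin.
have mF1 : measurable_fun setT F1.
  apply: emeasurable_funM; apply: emeasurable_funM; do ? exact: measurableT_comp.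
  - exact: measurable_le_indic.
  - exact: measurable_le_indic.
have mF2 : measurable_fun setT F2.
  apply: emeasurable_funM; apply: emeasurable_funM; do ? exact: measurableT_comp.
  - exact: measurable_le_indic.
  - exact: measurable_lt_indic.
have -> : (\int[leb]_(v in `[s, +oo[) f v) * (\int[leb]_(u in `[s, +oo[) g u) =
    \int[leb]_v \int[leb]_u (F1 (v, u) + F2 (v, u)).
  rewrite -ge0_integralZr//; [|exact: measurable_funTS|exact: integral_ge0].
  rewrite [LHS]tail_integralE; apply: eq_integral => v _.
  have mg' : measurable_fun setT (fun x : measurableTypeR R => (s <= x)%R%:R%:E * g x).
    by apply: emeasurable_funM => //; exact: measurable_le_indic.
  have g0' x : 0 <= (s <= x)%R%:R%:E * g x by rewrite mule_ge0// lee_fin.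
  rewrite tail_integralE -ge0_integralZl// -ge0_integralZl//; first last.
  - by move=> x _; rewrite mule_ge0.
  - by apply: emeasurable_funM => //; exact: measurable_cst.
  apply: eq_integral => x _; rewrite /F1 /F2/=.
  have [sv|vs] := leP s v; last first.
    rewrite !mul0e add0e; case: (leP v x) => [vx|xv]; first by rewrite mul0e mule0.
    by rewrite leNgt (lt_trans xv vs) !mul0e.
  rewrite !mul1e; have [vx|xv] := leP v x.
    by rewrite (le_trans sv vx) mul0e mule0 adde0.
  by rewrite mul0e mule0 add0e mul1e muleC.
have mF1v v : measurable_fun setT (fun u => F1 (v, u)).
  by apply: (measurableT_comp mF1); exact: measurable_pair1.
have mF2v v : measurable_fun setT (fun u => F2 (v, u)).
  by apply: (measurableT_comp mF2); exact: measurable_pair1.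
under eq_integral do rewrite ge0_integralD//.
rewrite ge0_integralD//; first last.
- exact: (measurable_fun_fubini_tonelli_F F2).
- by move=> v _; exact: integral_ge0.
- exact: (measurable_fun_fubini_tonelli_F F1).
- by move=> v _; exact: integral_ge0.
rewrite addeC; congr (_ + _).
  rewrite (fubini_tonelli F2)// [RHS]tail_integralE; apply: eq_integral => u _.
  rewrite (open_tail_integralE u mf) muleA -ge0_integralZl//.
  - by apply: emeasurable_funM => //; exact: measurable_lt_indic.
  - by move=> v _; rewrite mule_ge0// lee_fin.
  - by rewrite mule_ge0// lee_fin.
rewrite [RHS]tail_integralE; apply: eq_integral => v _.
rewrite (tail_integralE g v) muleA -ge0_integralZl//.
- by apply: emeasurable_funM => //; exact: measurable_le_indic.
- by move=> u _; rewrite mule_ge0// lee_fin.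
- by rewrite mule_ge0// lee_fin.
Qed.

(** The integral of [V u_1 * ... * V u_n] over [s <= u_1 <= ... <= u_n]. The
    powers of a tail integral are expressed by it because the cube is a union of
    [n`!] copies of the ordered simplex, one for each order of the coordinates. *)
Fixpoint simplex_integral (V : R -> \bar R) (n : nat) (s : R) : \bar R :=
  if n is m.+1 then \int[leb]_(u in `[s, +oo[) (V u * simplex_integral V m u)
  else 1.

Lemma simplex_integral_ge0 V n s : (forall x, 0 <= V x) ->
  0 <= simplex_integral V n s.
Proof.
move=> V0; elim: n s => [|n IH] s //=.
by apply: integral_ge0 => u _; rewrite mule_ge0.
Qed.

Lemma simplex_integral_joint_measurable d (T : measurableType d)
    (V : R -> T -> \bar R) n :
  (forall t w, 0 <= V t w) ->
  measurable_fun setT (fun x : measurableTypeR R * T => V x.1 x.2) ->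
  measurable_fun setT (fun x : measurableTypeR R * T => simplex_integral (V ^~ x.2) n x.1).
Proof.
move=> V0 mV; elim: n => [|n IH] /=; first exact: measurable_cst.
apply: (@tail_integral_measurable _ _
  (fun x => V x.1 x.2 * simplex_integral (V ^~ x.2) n x.1)).
  by move=> x; rewrite mule_ge0// simplex_integral_ge0.
exact: emeasurable_funM.
Qed.

Lemma simplex_integral_measurable V n :
  (forall x, 0 <= V x) -> measurable_fun setT V ->
  measurable_fun setT (simplex_integral V n).
Proof.
move=> V0 mV.
have := @simplex_integral_joint_measurable _ _ (fun t (_ : measurableTypeR R) => V t) n.
move=> /(_ (fun t _ => V0 t)) h.
have /h {}h : measurable_fun setT (fun x : measurableTypeR R * measurableTypeR R => V x.1).
  exact: measurableT_comp.
exact: (measurableT_comp h (@pair2_measurable _ _ (measurableTypeR R) (measurableTypeR R) 0%R)).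
Qed.

(** Inserting one more unordered point into an ordered [n]-tuple can be done in
    [n.+1] places: either it comes first, or it is inserted into the tail, which
    is the induction hypothesis. *)
Lemma simplex_integralM V n s :
  (forall x, 0 <= V x) -> measurable_fun setT V ->
  simplex_integral V 1 s * simplex_integral V n s =
  n.+1%:R%:E * simplex_integral V n.+1 s.
Proof.
move=> V0 mV; elim: n s => [|n IH] s; first by rewrite mule1 mul1e.
have mS k : measurable_fun setT (simplex_integral V k) by exact: simplex_integral_measurable.
have S0 k x : 0 <= simplex_integral V k x by exact: simplex_integral_ge0.
have S1 x : simplex_integral V 1 x = \int[leb]_(u in `[x, +oo[) V u.
  by rewrite /=; under eq_integral do rewrite mule1.
have SS x : simplex_integral V n.+1 x =
  \int[leb]_(u in `[x, +oo[) (V u * simplex_integral V n u) by [].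
rewrite S1 SS.
rewrite tail_integral_prod//; first last.
- exact: emeasurable_funM.
- by move=> x; rewrite mule_ge0.
rewrite (_ : \int[leb]_(v in `[s, +oo[) (V v * \int[leb]_(u in `[v, +oo[) (V u * simplex_integral V n u)) =
  simplex_integral V n.+2 s)//.
have -> : n.+2%:R%:E = n.+1%:R%:E + 1 :> \bar R by rewrite -EFinD natr1.
rewrite ge0_muleDl ?mul1e ?lee_fin//; congr (_ + _).
rewrite [X in _ * X]/= -ge0_integralZl//=; first last.
- by move=> u _; rewrite mule_ge0//; exact: (S0 n.+1).
- by apply: measurable_funTS; apply: emeasurable_funM => //; exact: (mS n.+1).
apply: eq_integral => u _.
rewrite -muleA [RHS]muleCA -SS -IH S1; congr (_ * _).
exact: muleC.
Qed.

Lemma simplex_integralX V n s :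
  (forall x, 0 <= V x) -> measurable_fun setT V ->
  (\int[leb]_(u in `[s, +oo[) V u) ^+ n = n`!%:R%:E * simplex_integral V n s.
Proof.
move=> V0 mV; elim: n => [|n IH]; first by rewrite expe0 mul1e.
rewrite expeS IH muleCA.
rewrite (_ : \int[leb]_(u in `[s, +oo[) V u = simplex_integral V 1 s).
  by rewrite simplex_integralM// muleA -EFinM -natrM mulnC factS.
by rewrite /=; under [RHS]eq_integral do rewrite mule1.
Qed.

End tail_integrals.

(** * Moments of the exponential functional *)

Section subordinator.
Context (R : realType) (d : measure_display) (T : measurableType d).
Context (P : probability T R) (lam : R) (N : R -> {RV P >-> nat}).
Context (Z : nat -> {RV P >-> nat}) (q mu : R).
Hypothesis lam_gt0 : 0 < lam.
Hypothesis N_poisson : poisson_process P lam (fun t => N t : T -> nat).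
Hypothesis Z_iid : iid P (fun i => Z i : T -> nat).
Hypothesis NZ_indep : indep_systems P
       (sigma_family [set t : R | 0 <= t] (fun t => N t : T -> nat))
       (sigma_family [set: nat] (fun i => Z i : T -> nat)).
Hypothesis q01 : 0 < q < 1.
Hypothesis mu_gt0 : 0 < mu.

Definition jump_pgf (x : R) : R := fine (\int[P]_w (x ^+ Z 0 w)%:E)%E.

Let GN := \bigcup_(t in [set t : R | 0 <= t])
  preimage_set_system setT (N t : T -> nat) measurable.
Let GZ := \bigcup_(i in [set: nat])
  preimage_set_system setT (Z i : T -> nat) measurable.

Let N_event t (B : set nat) : 0 <= t ->
  sigma_family [set t : R | 0 <= t] (fun t => N t : T -> nat) (N t @^-1` B).
Proof.
move=> t0; apply: sub_sigma_algebra; exists t => //.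
by exists B => //; rewrite setTI.
Qed.

Let Z_event i (B : set nat) :
  sigma_family [set: nat] (fun i => Z i : T -> nat) (Z i @^-1` B).
Proof.
by apply: sub_sigma_algebra; exists i => //; exists B => //; rewrite setTI.
Qed.

Lemma RV_preimage_measurable (X : {RV P >-> nat}) (B : set nat) : measurable (X @^-1` B).
Proof. by rewrite -[X in measurable X]setTI; exact: measurable_funPT. Qed.

Lemma jump_pgfE (i : nat) (x : R) : 0 <= x <= 1 ->
  (\int[P]_w (x ^+ Z i w)%:E = (jump_pgf x)%:E)%E.
Proof.
move=> /andP[x0 x1].
have eqlaw j : (\int[P]_w (x ^+ Z j w)%:E = \int[P]_w (x ^+ Z 0 w)%:E)%E.
  have xn0 n : 0 <= x ^+ n by exact: exprn_ge0.
  rewrite (@integral_nat_valued _ _ _ P (Z j) (fun n => x ^+ n))//; last first.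
    by move=> n; exact: RV_preimage_measurable.
  rewrite (@integral_nat_valued _ _ _ P (Z 0) (fun n => x ^+ n))//; last first.
    by move=> n; exact: RV_preimage_measurable.
  apply: eq_eseriesr => n _; congr (_ * _)%E.
  exact: Z_iid.2.
rewrite eqlaw fineK// ge0_fin_numE; last first.
  by apply: integral_ge0 => w _; rewrite lee_fin exprn_ge0.
apply: (@le_lt_trans _ _ (\int[P]_w (cst 1 w))%E); last first.
  by rewrite integral_cst// mul1e (le_lt_trans (probability_le1 _ _)) ?ltry.
apply: ge0_le_integral => //.
- by move=> w _; rewrite lee_fin exprn_ge0.
- apply/measurable_EFinP; apply: (nat_valued_measurable (fun n => x ^+ n)).
  by move=> n; exact: RV_preimage_measurable.
- by move=> w _; rewrite lee_fin exprn_ile1.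
Qed.

(** Jumps and counts being independent, conditioning on an event of the counting
    process does not change the law of the jumps. *)
Lemma integral_jumps (A : set T) (x : nat -> R) (m : nat) :
  sigma_family [set t : R | 0 <= t] (fun t => N t : T -> nat) A ->
  measurable A ->
  (forall j, 0 <= x j <= 1) ->
  (\int[P]_(w in A) (\prod_(j < m) x j ^+ Z j w)%:E =
   P A * (\prod_(j < m) jump_pgf (x j))%:E)%E.
Proof.
move=> NA mA x01.
under eq_integral do rewrite -(big_mkord xpredT (fun j => x j ^+ Z j _)) /index_iota subn0.
rewrite (@integral_indep_prod _ _ _ P _ (fun i => Z i : T -> nat) _ (fun j n => x j ^+ n)).
- rewrite -(big_mkord xpredT (fun j => jump_pgf (x j))) /index_iota subn0 -prodEFin.
  by congr (_ * _)%E; apply: eq_bigr => j _; rewrite jump_pgfE.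
- exact: iota_uniq.
- exact: mA.
- by move=> i n; exact: RV_preimage_measurable.
- by move=> i n; have /andP[x0 x1] := x01 i; rewrite exprn_ge0// exprn_ile1.
- move=> B; rewrite NZ_indep//; last first.
    apply: (@fin_bigcap_measurable _ (g_sigma_algebraType GZ)).
      exact: finite_seq.
    by move=> i _; exact: Z_event.
  by rewrite (Z_iid.1 (iota 0 m) B)// iota_uniq.
Qed.

Let S := compound (fun t => N t : T -> nat) (fun i => Z i : T -> nat).

Let q_ge0 : 0 <= q. Proof. by case/andP: q01 => /ltW. Qed.
Let q_le1 : q <= 1. Proof. by case/andP: q01 => _ /ltW. Qed.

Let qX01 n : 0 <= q ^+ n <= 1.
Proof. by rewrite exprn_ge0//= exprn_ile1. Qed.

Lemma jump_pgf01 x : 0 <= x <= 1 -> 0 <= jump_pgf x <= 1.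
Proof.
move=> x01; have /andP[x0 x1] := x01.
rewrite -!lee_fin -(jump_pgfE 0 x01); apply/andP; split.
  by apply: integral_ge0 => w _; rewrite lee_fin exprn_ge0.
apply: (@le_trans _ _ (\int[P]_w (cst 1 w))%E); last first.
  by rewrite integral_cst// mul1e probability_le1.
apply: ge0_le_integral => //.
- by move=> w _; rewrite lee_fin exprn_ge0.
- apply/measurable_EFinP; apply: (nat_valued_measurable (fun n => x ^+ n)).
  by move=> n; exact: RV_preimage_measurable.
- by move=> w _; rewrite lee_fin exprn_ile1.
Qed.

Lemma increment_measurable (s t : R) (n : nat) :
  measurable ((fun w => (N t w - N s w)%N) @^-1` [set n]).
Proof.
apply: (@measurable_nat_family _ _ (N s) (fun i w => (N t w - i)%N)) => i.
  exact: RV_preimage_measurable.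
by move=> j; exact: (@RV_preimage_measurable (N t) [set l | (l - i)%N = j]).
Qed.

Lemma integral_increments (t : nat -> R) (x : nat -> R) (m : nat) :
  t 0 = 0 -> {homo t : i j / (i <= j)%N >-> i <= j} ->
  (forall k, 0 <= x k <= 1) ->
  (\int[P]_w (\prod_(k < m) x k ^+ (N (t k.+1) w - N (t k) w))%:E =
   (\prod_(k < m) expR (- (lam * (t k.+1 - t k)) * (1 - x k)))%:E)%E.
Proof.
move=> t0 ht x01.
have t_ge0 k : 0 <= t k by rewrite -t0 ht.
have mincr k := increment_measurable (t k) (t k.+1).
under eq_integral do rewrite -(big_mkord xpredT (fun k => x k ^+ (N (t k.+1) _ - N (t k) _))) /index_iota subn0.
rewrite (@integral_indep_prod _ _ _ P _ (fun k w => (N (t k.+1) w - N (t k) w)%N) _ (fun k n => x k ^+ n)).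
- rewrite probability_setT mul1e.
  rewrite -(big_mkord xpredT (fun k => expR (- (lam * (t k.+1 - t k)) * (1 - x k)))) /index_iota subn0 -prodEFin.
  apply: eq_bigr => k _.
  have : t k <= t k.+1 by exact: ht.
  rewrite le_eqVlt => /orP[/eqP tk|tk].
    rewrite -tk subrr mulr0 oppr0 mul0r expR0.
    under eq_integral do rewrite subnn expr0.
    by rewrite integral_cst// mul1e; exact: probability_setT.
  apply: poisson_pgf => //.
  - by rewrite mulr_gt0 ?subr_gt0.
  - by move=> n; exact: (poisson_process_incr N_poisson).
- exact: iota_uniq.
- exact: measurableT.
- exact: mincr.
- by move=> i n; have /andP[x0 x1] := x01 i; rewrite exprn_ge0// exprn_ile1.
- move=> B; rewrite setTI probability_setT mul1e.
  by apply: (poisson_process_indep N_poisson (t := t)) => //; rewrite ?t0// iota_uniq.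
Qed.

Lemma partial_sum_measurable (i k : nat) :
  measurable ((fun w => (\sum_(j < i) Z j w)%N) @^-1` [set k]).
Proof.
elim: i k => [|i IH] k.
  case: k => [|k].
    rewrite (_ : _ @^-1` _ = setT)//; apply/seteqP; split=> w//= _.
    by rewrite big_ord0.
  rewrite (_ : _ @^-1` _ = set0)//; apply/seteqP; split=> w//=.
  by rewrite big_ord0.
under [X in _ X]eq_set do rewrite big_ord_recr/=.
apply: (@measurable_nat_family _ _ (Z i) (fun l w => (\sum_(j < i) Z j w + l)%N)) => l.
  exact: RV_preimage_measurable.
move=> j; have [lj|lj] := leqP l j.
  rewrite (_ : _ @^-1` _ = (fun w => (\sum_(j < i) Z j w)%N) @^-1` [set (j - l)%N])//.
  apply/seteqP; split=> w /= => [<-|->]; first by rewrite addnK.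
  by rewrite subnK.
rewrite (_ : _ @^-1` _ = set0)//; apply/seteqP; split=> w //= wj.
by move: lj; rewrite -wj ltnNge leq_addl.
Qed.

Lemma compound_measurable t n : measurable (S t @^-1` [set n]).
Proof.
apply: (@measurable_nat_family _ _ (N t) (fun i w => (\sum_(j < i) Z j w)%N)) => i.
  exact: RV_preimage_measurable.
by move=> k; exact: partial_sum_measurable.
Qed.

(** Given the counting process, jump number [j] contributes the factor
    [jump_pgf (q ^+ nb_above _ m j)]; by [prod_nb_above] this leaves powers of
    the independent Poisson increments, whose generating functions are known.
    The conditioning is discrete: the counts at the times [t 1 .. t m] are
    encoded into the single integer [K w]. *)
Lemma compound_fidi (t : nat -> R) (m : nat) :
  t 0 = 0 -> {homo t : i j / (i <= j)%N >-> i <= j} ->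
  (\int[P]_w (\prod_(k < m) q ^+ S (t k.+1) w)%:E =
   (\prod_(k < m) expR (- (lam * (t k.+1 - t k)) * (1 - jump_pgf (q ^+ (m - k)))))%:E)%E.
Proof.
move=> t0 ht.
have t_ge0 k : 0 <= t k by rewrite -t0 ht.
have N0 w : N (t 0) w = 0%N by rewrite t0 (poisson_process0 N_poisson).
have hN w : {homo (fun k => N (t k) w) : i j / (i <= j)%N}.
  by move=> i j ij; apply: (poisson_process_nd N_poisson) => //; exact: ht.
rewrite -(@integral_increments t (fun k => jump_pgf (q ^+ (m - k))))//; last first.
  by move=> k; exact: jump_pgf01.
(* all the counts up to the last time, in one countable value *)
pose v w := [seq N (t k.+1) w | k <- iota 0 m].
pose K w := pickle (v w).
have vE w w' k : v w = v w' -> (k < m)%N -> N (t k.+1) w = N (t k.+1) w'.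
  move=> vw km; move: vw => /(congr1 (nth 0%N ^~ k)).
  by rewrite !(nth_map 0%N) ?size_iota// !nth_iota.
have vP w0 : K @^-1` [set K w0] =
    \bigcap_(k in [set` iota 0 m]) (N (t k.+1) @^-1` [set N (t k.+1) w0]).
  apply/seteqP; split=> [w /= /(pcan_inj pickleK) vw k /=|w /= h].
    by rewrite mem_iota/= => km; exact: vE vw km.
  by congr pickle; apply/eq_in_map => k km; exact: h.
have NK w0 : sigma_family [set t : R | 0 <= t] (fun t => N t : T -> nat) (K @^-1` [set K w0]).
  rewrite vP; apply: (@fin_bigcap_measurable _ (g_sigma_algebraType GN)).
    exact: finite_seq.
  by move=> k _; exact: N_event.
have mK0 w0 : measurable (K @^-1` [set K w0]).
  rewrite vP; apply: fin_bigcap_measurable; first exact: finite_seq.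
  by move=> k _; exact: RV_preimage_measurable.
have Kn n : K @^-1` [set n] = set0 \/ exists w0, n = K w0.
  have [->|/set0P[w0 /= <-]] := eqVneq (K @^-1` [set n]) set0; first by left.
  by right; exists w0.
have mK n : measurable (K @^-1` [set n]).
  by case: (Kn n) => [->//|[w0 ->]].
have eqN w w0 k : K w = K w0 -> (k < m.+1)%N -> N (t k) w = N (t k) w0.
  case: k => [_ _|k /(pcan_inj pickleK) vw km]; first by rewrite !N0.
  exact: vE.
have nbE w w0 j : K w = K w0 ->
    nb_above (fun k => N (t k) w) m j = nb_above (fun k => N (t k) w0) m j.
  by move=> ww0; rewrite /nb_above; apply: eq_bigr => k _; rewrite (eqN _ _ _ ww0) ?ltnS.
have mP (X : nat -> T -> nat) :
    (forall k n, measurable (X k @^-1` [set n])) ->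
    forall a : nat -> R, measurable_fun setT (fun w => (\prod_(k < m) (a k ^+ X k w))%:E).
  move=> mX a; apply/measurable_EFinP; apply: measurable_prodr => k.
  exact: (nat_valued_measurable (fun n => a k ^+ n)).
rewrite [LHS](integral_nat_partition P (K := K))//; last 2 first.
- apply: (mP (fun k => S (t k.+1)) _ (fun=> q)) => k n.
  exact: compound_measurable.
- by move=> w _; rewrite lee_fin prodr_ge0// => k _; rewrite exprn_ge0.
rewrite [RHS](integral_nat_partition P (K := K))//; last 2 first.
- apply: (mP (fun k w => (N (t k.+1) w - N (t k) w)%N) _ (fun k => jump_pgf (q ^+ (m - k)))) => k n.
  exact: increment_measurable.
- move=> w _; rewrite lee_fin prodr_ge0// => k _; rewrite exprn_ge0//.
  by case/andP: (jump_pgf01 (qX01 (m - k))).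
apply: eq_eseriesr => n _; rewrite setTI.
case: (Kn n) => [->|[w0 ->]]; first by rewrite !integral_set0.
transitivity (\int[P]_(w in K @^-1` [set K w0])
    (\prod_(j < N (t m) w0) (q ^+ nb_above (fun k => N (t k) w0) m j) ^+ Z j w)%:E)%E.
  apply: eq_integral => w /[!inE] /= ww0; congr EFin.
  rewrite (prod_partial_sums _ (Z ^~ w) m (hN w)) (eqN _ _ _ ww0)//.
  by apply: eq_bigr => j _; rewrite (nbE _ _ _ ww0).
rewrite (@integral_jumps _ (fun j => q ^+ nb_above (fun k => N (t k) w0) m j))//.
rewrite muleC -integral_cst//; apply: eq_integral => w /[!inE] /= ww0; congr EFin.
rewrite -(prod_nb_above (fun n => jump_pgf (q ^+ n)) m (N0 w) (hN w)).
rewrite (eqN _ _ _ ww0)//; apply: eq_bigr => j _.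
by rewrite (nbE _ _ _ ww0).
Qed.

Let muq := - ln q * mu.

(** [q] to the power [S t + mu * t], the integrand of the functional; the
    indicator makes it measurable jointly in [(t, w)] on the whole line, since
    nothing is known of [N t] for negative [t]. *)
Definition discount (t : R) (w : T) : R :=
  (0 <= t)%R%:R * (q ^+ S t w * expR (- (muq * t))).

Let Npos (x : measurableTypeR R * T) : nat := if 0 <= x.1 then N x.1 x.2 else 0%N.

(** A right-continuous integer-valued path is constant on a small interval to
    the right of [t], which contains a rational. *)
Lemma count_right_constant (t : R) w : 0 <= t ->
  exists2 r : rat, t < ratr r & N (ratr r) w = N t w.
Proof.
move=> t0; have [e /= e0 he] :=
  @poisson_process_rcont _ _ _ _ _ _ N_poisson w t t0 _ (discrete_set1 (N t w)).
have [r] := @rat_in_itvoo R t (t + e) ltac:(by rewrite ltrDl).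
rewrite in_itv/= => /andP[tr re]; exists r => //.
by apply: he => //=; rewrite ltr0_norm ?subr_lt0// opprB ltrBlDl.
Qed.

(** Since paths are nondecreasing and right-continuous, [N t w <= m] amounts to
    [N r w <= m] for some rational [r > t], a countable union of rectangles. *)
Lemma count_joint_measurable n : measurable (Npos @^-1` [set n]).
Proof.
have mle m : measurable [set x | (Npos x <= m)%N].
  have -> : [set x | (Npos x <= m)%N] = `]-oo, (0:R)[ `*` setT `|`
     \bigcup_(r : rat) (`[0, (ratr r : R)[ `*` [set w | (N (ratr r) w <= m)%N]).
    apply/seteqP; split=> [[t w] /=|[t w] /=]; rewrite /Npos/=; have [t0|t0] := leP 0 t.
    - move=> Nm; right.
      have [r tr Nr] := count_right_constant w t0.
      by exists r => //=; rewrite Nr in_itv/= t0 tr.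
    - by move=> _; left; rewrite in_itv/=.
    - case=> [[]|[r _ [/=]]]; first by rewrite in_itv/= ltNge t0.
      rewrite in_itv/= => /andP[_ tr] Nm; apply: leq_trans Nm.
      by apply: (poisson_process_nd N_poisson) => //; exact: ltW.
    - by [].
  apply: measurableU; first exact: measurableX.
  apply: bigcupT_measurable_rat => r; apply: measurableX => //.
  exact: (@RV_preimage_measurable (N (ratr r)) [set k | (k <= m)%N]).
case: n => [|n].
  rewrite (_ : _ @^-1` _ = [set x | (Npos x <= 0)%N])//.
  by apply/seteqP; split=> x /=; rewrite leqn0 => /eqP.
rewrite (_ : _ @^-1` _ = [set x | (Npos x <= n.+1)%N] `\` [set x | (Npos x <= n)%N]).
  exact: measurableD.
apply/seteqP; split=> x /=; first by move=> ->; rewrite ltnn.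
by case=> h1 /negP; rewrite -ltnNge => h2; apply/eqP; rewrite eqn_leq h1.
Qed.

Lemma discount_joint_measurable :
  measurable_fun setT (fun x : measurableTypeR R * T => discount x.1 x.2).
Proof.
pose Spos (x : measurableTypeR R * T) : nat := (\sum_(j < Npos x) Z j x.2)%N.
have mS n : measurable (Spos @^-1` [set n]).
  apply: (@measurable_nat_family _ _ Npos (fun i x => (\sum_(j < i) Z j x.2)%N)) => i.
    exact: count_joint_measurable.
  move=> k; have := partial_sum_measurable i k.
  move=> /(measurableX (measurableT : measurable [set: measurableTypeR R])).
  by rewrite (_ : _ `*` _ = (fun x : measurableTypeR R * T => (\sum_(j < i) Z j x.2)%N) @^-1` [set k])//; apply/seteqP; split=> x //= [].
have -> : (fun x : measurableTypeR R * T => discount x.1 x.2) =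
    (fun x => \1_(`[0, +oo[ : set R) x.1 * (q ^+ Spos x * expR (- (muq * x.1)))).
  apply/funext => -[t w]; rewrite /discount /= indicE /Spos /Npos/= mem_setE in_itv/= andbT.
  by case: leP; rewrite ?mul0r ?mul1r.
apply: measurable_funM.
  exact: measurableT_comp (measurable_indic _) _.
apply: measurable_funM.
  exact: (nat_valued_measurable (fun n => q ^+ n)).
apply: measurableT_comp => //; apply: measurableT_comp => //.
exact: measurable_funM.
Qed.

Lemma muq_gt0 : 0 < muq.
Proof. by rewrite /muq mulr_gt0// oppr_gt0 ln_lt0. Qed.

(** The expectation of the [n]-th power of [q `^ (S t + mu * t)] is
    [expR (- (t * laplace_exponent n))]. *)
Definition laplace_exponent (n : nat) : R :=
  n%:R * muq + lam * (1 - jump_pgf (q ^+ n)).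

Lemma laplace_exponent_gt0 n : (0 < n)%N -> 0 < laplace_exponent n.
Proof.
move=> n0; rewrite /laplace_exponent ltr_wpDr//; last first.
  by apply: mulr_gt0; [rewrite ltr0n|exact: muq_gt0].
by rewrite mulr_ge0 ?(ltW lam_gt0)// subr_ge0; case/andP: (jump_pgf01 (qX01 n)).
Qed.

Lemma discount_ge0 t w : 0 <= discount t w.
Proof. by rewrite /discount !mulr_ge0 ?expR_ge0 ?exprn_ge0. Qed.

Lemma discount_le t w : 0 <= t -> discount t w <= expR (- (muq * t)).
Proof. by move=> t0; rewrite /discount t0 mul1r ler_piMl ?expR_ge0// exprn_ile1. Qed.

Lemma sum_by_parts (t : nat -> R) m : t 0%N = 0 ->
  \sum_(k < m) t k.+1 = \sum_(k < m) (m - k)%:R * (t k.+1 - t k).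
Proof.
move=> t0; elim: m => [|m IH]; first by rewrite !big_ord0.
rewrite !big_ord_recr/= subSnn mul1r IH.
rewrite [in RHS](eq_bigr (fun k : 'I_m => (m - k)%:R * (t k.+1 - t k) + (t k.+1 - t k))); last first.
  by move=> k _; rewrite subSn ?(ltnW (ltn_ord k))// -natr1 mulrDl mul1r.
rewrite big_split/= -(big_mkord xpredT (fun k => t k.+1 - t k)) telescope_sumr// t0.
by rewrite subr0 -addrA; congr (_ + _); rewrite addrC subrK.
Qed.

(** Independence and stationarity of the increments: the increment
    from [t k] to [t k.+1] enters the [m - k] last factors, so that it is
    discounted at the rate [laplace_exponent (m - k)]. *)
Lemma discount_fidi (t : nat -> R) (m : nat) :
  t 0 = 0 -> {homo t : i j / (i <= j)%N >-> i <= j} ->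
  (\int[P]_w (\prod_(k < m) discount (t k.+1) w)%:E =
   (\prod_(k < m) expR (- ((t k.+1 - t k) * laplace_exponent (m - k))))%:E)%E.
Proof.
move=> t0 ht.
have t_ge0 k : 0 <= t k by rewrite -t0 ht.
under eq_integral => w _.
  rewrite (eq_bigr (fun k : 'I_m => expR (- (muq * t k.+1)) * q ^+ S (t k.+1) w)); last first.
    by move=> k _; rewrite /discount t_ge0 mul1r mulrC.
  rewrite big_split/= EFinM; over.
rewrite ge0_integralZl//; first last.
- by rewrite lee_fin prodr_ge0// => k _; exact: expR_ge0.
- by move=> w _; rewrite lee_fin prodr_ge0// => k _; rewrite exprn_ge0.
- apply/measurable_EFinP; apply: measurable_prodr => k.
  apply: (nat_valued_measurable (fun n => q ^+ n)).
  by move=> n; exact: compound_measurable.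
rewrite compound_fidi// -EFinM; congr EFin.
rewrite -!expR_sum -expRD; congr expR.
rewrite sumrN -mulr_sumr sum_by_parts// mulr_sumr -sumrN -big_split/=.
by apply: eq_bigr => k _; rewrite /laplace_exponent; ring.
Qed.

Let disc w (t : R) : \bar R := (discount t w)%:E.

Let disc_ge0 w t : (0 <= disc w t)%E.
Proof. by rewrite lee_fin discount_ge0. Qed.

Let disc_joint : measurable_fun setT (fun x : measurableTypeR R * T => disc x.2 x.1).
Proof. by apply/measurable_EFinP; exact: discount_joint_measurable. Qed.

Let disc_meas w : measurable_fun setT (disc w).
Proof.
exact: (measurableT_comp disc_joint (@pair2_measurable _ _ (measurableTypeR R) T w)).
Qed.

Let disc_measT t : measurable_fun setT (disc ^~ t).
Proof.
exact: (measurableT_comp disc_joint (@pair1_measurable _ _ (measurableTypeR R) T t)).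
Qed.

(** The integral over the last [n] ordered times is computed one time after the
    other, integrating the exponentials of [discount_fidi] from the latest time
    down to the earliest. The first [m] times are kept fixed, so that the
    induction hypothesis can be applied with one more fixed time. *)
Lemma simplex_expectation n (m : nat) (t : nat -> R) :
  t 0 = 0 -> {homo t : i j / (i <= j)%N >-> i <= j} ->
  (\int[P]_w ((\prod_(k < m) discount (t k.+1) w)%:E * simplex_integral (disc w) n (t m)) =
   (\prod_(i < n) (laplace_exponent i.+1)^-1 *
    \prod_(k < m) expR (- ((t k.+1 - t k) * laplace_exponent (n + m - k))))%:E)%E.
Proof.
elim: n m t => [|n IH] m t t0 ht.
  rewrite big_ord0 mul1r -discount_fidi//.
  by under eq_integral do rewrite mule1.
set s := t m; pose c := \prod_(i < n) (laplace_exponent i.+1)^-1.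
pose W w := \prod_(k < m) discount (t k.+1) w.
have W0 w : 0 <= W w by apply: prodr_ge0 => k _; exact: discount_ge0.
have mW : measurable_fun setT W.
  by apply: measurable_prodr => k; apply/measurable_EFinP; exact: disc_measT.
pose F (z : T * measurableTypeR R) : \bar R :=
  ((s <= z.2)%R%:R%:E * ((W z.1)%:E * (disc z.1 z.2 * simplex_integral (disc z.1) n z.2)))%E.
have F0 z : (0 <= F z)%E.
  by rewrite /F !mule_ge0// ?lee_fin// simplex_integral_ge0.
have swap : measurable_fun setT (fun z : T * measurableTypeR R => (z.2, z.1)).
  exact: measurable_swap.
have mS : measurable_fun setT (fun z : T * measurableTypeR R => simplex_integral (disc z.1) n z.2).
  have := @simplex_integral_joint_measurable R _ T (fun t w => disc w t) n.
  move=> /(_ (fun t w => disc_ge0 w t) disc_joint) h.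
  exact: (measurableT_comp h swap).
have mF : measurable_fun setT F.
  apply: emeasurable_funM; first exact: measurable_le_indic.
  apply: emeasurable_funM; first by apply/measurable_EFinP; exact: measurableT_comp.
  apply: emeasurable_funM => //; exact: (measurableT_comp disc_joint swap).
have mSw w : measurable_fun setT (simplex_integral (disc w) n).
  by apply: simplex_integral_measurable; [exact: disc_ge0|exact: disc_meas].
transitivity (\int[P]_w \int[lebesgue_measure]_u F (w, u))%E.
  apply: eq_integral => w _; rewrite /= tail_integralE -ge0_integralZl//; first last.
  - by rewrite lee_fin W0.
  - by move=> u _; rewrite !mule_ge0// ?lee_fin// simplex_integral_ge0.
  - apply: emeasurable_funM; first exact: measurable_le_indic.
    by apply: emeasurable_funM; [exact: (disc_meas w)|exact: (mSw w)].
  - by apply: eq_integral => u _; rewrite muleCA.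
rewrite fubini_tonelli//.
(* the induction hypothesis with [u] as a fixed time after [t m] *)
have key u : s <= u -> (\int[P]_w ((W w)%:E * (disc w u * simplex_integral (disc w) n u)) =
  (c * \prod_(k < m) expR (- ((t k.+1 - t k) * laplace_exponent (n.+1 + m - k))))%:E *
  (expR (- ((u - s) * laplace_exponent n.+1)))%:E)%E.
  move=> su; pose t' k := if (k <= m)%N then t k else u.
  have t'0 : t' 0 = 0 by [].
  have ht' : {homo t' : i j / (i <= j)%N >-> i <= j}.
    move=> i j ij; rewrite /t'; case: (leqP j m) => jm; first by rewrite (leq_trans ij jm) ht.
    case: (leqP i m) => im //; apply: le_trans su; exact: ht.
  have := IH m.+1 t' t'0 ht'.
  rewrite [X in X = _ -> _](_ : _ = (\int[P]_w ((W w)%:E * (disc w u * simplex_integral (disc w) n u)))%E); last first.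
    apply: eq_integral => w _; rewrite big_ord_recr/= {2 3}/t' ltnn muleA -EFinM; congr (_%:E * _)%E.
    by congr (_ * _); apply: eq_bigr => k _; rewrite /t' ltn_ord.
  move=> ->; rewrite -EFinM; congr EFin; rewrite -/c -[RHS]mulrA; congr (c * _).
  rewrite big_ord_recr/=; congr (_ * expR (- (_ * _))); last first.
  - by congr laplace_exponent; rewrite -addSnnS addnK.
  - by rewrite /t' ltnn leqnn.
  apply: eq_bigr => k _.
  by rewrite /t' ltn_ord (ltnW (ltn_ord k)) addnS addSn.
transitivity (\int[lebesgue_measure]_(u in `[s, +oo[)
   ((c * \prod_(k < m) expR (- ((t k.+1 - t k) * laplace_exponent (n.+1 + m - k))))%:E *
  (expR (- ((u - s) * laplace_exponent n.+1)))%:E))%E.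
  rewrite tail_integralE; apply: eq_integral => u _; rewrite /F/=.
  case: (leP s u) => su; last first.
    by rewrite mul0e; apply: integral0_eq => w _; rewrite mul0e.
  by rewrite mul1e -key//; apply: eq_integral => w _; rewrite mul1e.
rewrite ge0_integralZl//; first last.
- rewrite lee_fin mulr_ge0//; last by apply: prodr_ge0 => k _; exact: expR_ge0.
  by apply: prodr_ge0 => i _; rewrite invr_ge0 ltW// laplace_exponent_gt0.
- apply: measurable_funTS; apply/measurable_EFinP; apply: measurableT_comp => //.
  apply: measurableT_comp => //; apply: measurable_funM => //.
  exact: measurable_funB.
rewrite exponential_tail ?laplace_exponent_gt0// -EFinM; congr EFin.
by rewrite big_ord_recr/= -/c; ring.
Qed.

Let I := exp_functional q mu S.

Let discE t w : 0 <= t -> q `^ ((S t w)%:R + mu * t) = discount t w.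
Proof.
move=> t0; have q0 : 0 < q by case/andP: q01.
rewrite powRD; last by rewrite (gt_eqF q0) implybT.
rewrite /discount t0 mul1r powR_mulrn//; congr (_ * _).
by rewrite /powR (gt_eqF q0); congr expR; rewrite /muq; ring.
Qed.

Let discount_integral_le w :
  (\int[lebesgue_measure]_(t in `[0%R, +oo[) disc w t <= (muq^-1)%:E)%E.
Proof.
rewrite -(exponential_tail 0 muq_gt0); apply: ge0_le_integral => //.
- by apply: measurable_funTS; exact: disc_meas.
- apply: measurable_funTS; apply/measurable_EFinP; apply: measurableT_comp => //.
  by apply: measurableT_comp => //; apply: measurable_funM => //; exact: measurable_funB.
- move=> t; rewrite /= in_itv/= andbT => t0.
  by rewrite lee_fin subr0 mulrC discount_le.
Qed.

(** The functional is defined by a real-valued integral; it agrees with the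
    extended one because the discount is at most [exp (- muq * t)]. *)
Lemma exp_functionalE w :
  ((I w)%:E = \int[lebesgue_measure]_(t in `[0%R, +oo[) disc w t)%E.
Proof.
rewrite /I /exp_functional /Rintegral.
transitivity ((fine (\int[lebesgue_measure]_(t in `[0%R, +oo[) disc w t))%:E)%E.
  congr (fine _)%:E; apply: eq_integral => t.
  by rewrite inE/= in_itv/= andbT => t0; rewrite discE.
rewrite fineK// ge0_fin_numE ?integral_ge0//.
exact: le_lt_trans (discount_integral_le w) (ltry _).
Qed.

Lemma exp_functional_bounds w : 0 <= I w <= muq^-1.
Proof.
rewrite -!lee_fin exp_functionalE discount_integral_le andbT.
by apply: integral_ge0 => t _.
Qed.

Lemma exp_functional_measurable : measurable_fun setT I.
Proof.
apply/measurable_EFinP; rewrite (_ : EFin \o I = fun w => \int[lebesgue_measure]_(t in `[0%R, +oo[) disc w t)%E; last first.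
  by apply/funext => w; rewrite /= exp_functionalE.
have := @tail_integral_measurable R _ T (fun x => disc x.2 x.1) (fun x => disc_ge0 _ _) disc_joint.
move=> h; exact: (measurableT_comp h (@pair1_measurable _ _ (measurableTypeR R) T 0)).
Qed.

(** The case of no fixed time in [simplex_expectation], after
    [simplex_integralX] has turned the power into a simplex integral. *)
Lemma exp_functional_moment n :
  (\int[P]_w (I w ^+ n)%:E = (n`!%:R * \prod_(i < n) (laplace_exponent i.+1)^-1)%:E)%E.
Proof.
under eq_integral => w _.
  rewrite EFin_expe exp_functionalE simplex_integralX//; last exact: (disc_meas w).
  over.
rewrite /=.
rewrite ge0_integralZl//; first last.
- by move=> w _; exact: simplex_integral_ge0.
- have := @simplex_integral_joint_measurable R _ T (fun t w => disc w t) n.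
  move=> /(_ (fun t w => disc_ge0 w t) disc_joint) h.
  exact: (measurableT_comp h (@pair1_measurable _ _ (measurableTypeR R) T 0)).
rewrite EFinM; congr (_ * _)%E.
have := @simplex_expectation n 0 (fun=> 0) erefl (fun _ _ _ => lexx _).
rewrite big_ord0 mulr1 => <-; apply: eq_integral => w _.
by rewrite big_ord0 mul1e.
Qed.

Lemma jump_pgf_series (x : R) : 0 <= x <= 1 ->
  ((jump_pgf x)%:E =
   \sum_(k <oo) (fine (P [set w | Z 0%N w = k]) * x ^+ k)%:E)%E.
Proof.
move=> x01; have /andP[x0 x1] := x01.
rewrite -(jump_pgfE 0 x01) (@integral_nat_valued _ _ _ P (Z 0) (fun n => x ^+ n)); last 2 first.
- by move=> n; exact: RV_preimage_measurable.
- by move=> n; exact: exprn_ge0.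
apply: eq_eseriesr => n _; rewrite EFinM muleC fineK//.
by rewrite fin_num_measure//; exact: (@RV_preimage_measurable (Z 0) [set n]).
Qed.

Lemma prob_ge1 :
  fine (P [set w | (1 <= Z 0%N w)%N]) = 1 - fine (P [set w | Z 0%N w = 0%N]).
Proof.
have m0 : measurable [set w | Z 0%N w = 0%N] := @RV_preimage_measurable (Z 0) [set 0%N].
rewrite (_ : [set w | (1 <= Z 0%N w)%N] = ~` [set w | Z 0%N w = 0%N]); last first.
  by apply/seteqP; split=> w /=; rewrite lt0n => /eqP.
rewrite probability_setC// fineB// fin_num_measure//.
Qed.

End subordinator.

(** * A bounded law is determined by its moments *)

Section bernoulli.
Context (R : realType).

Lemma bernoulli_ge (x : R) n : -1 <= x -> 1 + n%:R * x <= (1 + x) ^+ n.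
Proof.
move=> x1; elim: n => [|n IH]; first by rewrite mul0r addr0 expr0.
rewrite exprS; apply: (@le_trans _ _ ((1 + x) * (1 + n%:R * x))).
  rewrite -natr1; have : 0 <= n%:R * (x * x) by rewrite mulr_ge0// -expr2 sqr_ge0.
  lra.
by rewrite ler_wpM2l//; lra.
Qed.

Lemma cvg_natr_geometric (r : R) : 0 <= r < 1 -> (n%:R * r ^+ n) @[n --> \oo] --> (0 : R).
Proof.
move=> /andP[r0 r1].
have [->|rn0] := eqVneq r 0.
  apply: (@cvg_trans _ ((fun=> (0:R)) @ \oo)); last exact: cvg_cst.
  by apply: near_eq_cvg; near=> n; rewrite expr0n gtn_eqF ?mulr0//; near: n; exact: nbhs_infty_gt.
pose s := Num.sqrt r.
have s0 : 0 < s by rewrite sqrtr_gt0 lt_def rn0 r0.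
have s1 : s < 1 by rewrite -sqrtr1 ltr_sqrt.
have rs : r = s * s by rewrite -expr2 sqr_sqrtr.
pose e := s^-1 - 1.
have e0 : 0 < e by rewrite subr_gt0 invf_gt1.
have bnd n : n%:R * s ^+ n <= e^-1.
  have : 1 + n%:R * e <= s^-1 ^+ n.
    rewrite [X in X ^+ n](_ : s^-1 = 1 + e); last by rewrite /e addrC subrK.
    by apply: bernoulli_ge; apply: le_trans (ltW e0); lra.
  rewrite exprVn -[leRHS]mul1r ler_pdivlMr ?exprn_gt0// => h.
  rewrite -[leRHS]mul1r ler_pdivlMr//; apply: le_trans h.
  by rewrite mulrDl mul1r mulrAC lerDr exprn_ge0// ltW.
apply: (@squeeze_cvgr _ _ _ _ (fun=> 0) (fun n => e^-1 * s ^+ n)).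
- near=> n; rewrite mulr_ge0 ?exprn_ge0//= rs exprMn mulrA.
  by apply: ler_wpM2r; [rewrite exprn_ge0// ltW|exact: bnd].
- exact: cvg_cst.
- rewrite -[X in _ --> X](mulr0 e^-1); apply: cvgM; first exact: cvg_cst.
  by apply: cvg_expr; rewrite gtr0_norm.
Unshelve. all: by end_near. Qed.

(** With [m = cutoff_exponent c n], a number slightly above [n / c ^ n], the
    polynomials [(1 - y ^ n) ^ m] converge on the unit interval to the indicator
    of [y < c]: the product [m * y ^ n] is about [n * (y / c) ^ n], which tends
    to [0] if [y < c] and is at least [n] otherwise. *)
Definition cutoff_exponent (c : R) (n : nat) : nat := (Num.truncn (n%:R / c ^+ n)).+1.

(** Below [c] the Bernoulli inequality gives [(1 - y ^ n) ^ m >= 1 - m * y ^ n].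
    Above [c] it gives [(1 + y ^ n) ^ m >= 1 + m * y ^ n >= n.+1], while
    [(1 - y ^ n) * (1 + y ^ n) <= 1]. *)
Lemma cvg_cutoff (c y : R) : 0 < c < 1 -> 0 <= y <= 1 ->
  ((1 - y ^+ n) ^+ cutoff_exponent c n) @[n --> \oo] --> ((y < c)%R%:R : R).
Proof.
move=> /andP[c0 c1] /andP[y0 y1].
have mP n : n%:R / c ^+ n <= (cutoff_exponent c n)%:R <= n%:R / c ^+ n + 1.
  have : 0 <= n%:R / c ^+ n by rewrite divr_ge0// exprn_ge0// ltW.
  move=> /truncn_itv/andP[h1 h2]; rewrite (ltW h2)/= -natr1 lerD2r//.
have yn n : 0 <= y ^+ n <= 1 by rewrite exprn_ge0//= exprn_ile1.
have [yc|cy] := ltP y c.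
  rewrite mulr1n; apply: (@squeeze_cvgr _ _ _ _
      (fun n => 1 - (n%:R * (y / c) ^+ n + y ^+ n)) (fun=> 1)).
  - near=> n; have /andP[yn0 yn1] := yn n.
    apply/andP; split; last by apply: exprn_ile1; lra.
    apply: (@le_trans _ _ (1 + (cutoff_exponent c n)%:R * (- y ^+ n))); last first.
      by apply: bernoulli_ge; lra.
    rewrite mulrN lerD2l lerN2 expr_div_n mulrA mulrAC.
    have /andP[_ h] := mP n.
    by apply: le_trans (ler_wpM2r yn0 h) _; rewrite mulrDl mul1r.
  - rewrite -[X in _ --> X]subr0 -[X in _ --> _ - X]addr0; apply: cvgB; first exact: cvg_cst.
    apply: cvgD.
      apply: cvg_natr_geometric; apply/andP; split.
        by apply: divr_ge0 => //; exact: ltW.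
      by rewrite ltr_pdivrMr// mul1r.
    by apply: cvg_expr; rewrite ger0_norm// (lt_trans yc).
  - exact: cvg_cst.
rewrite mulr0n; apply: (@squeeze_cvgr _ _ _ _ (fun=> 0) (fun n : nat => n.+1%:R^-1)).
- near=> n; have /andP[yn0 yn1] := yn n.
  rewrite exprn_ge0 ?subr_ge0//= -[leRHS]mul1r ler_pdivlMr ?ltr0n//.
  apply: (@le_trans _ _ ((1 - y ^+ n) ^+ cutoff_exponent c n * (1 + y ^+ n) ^+ cutoff_exponent c n)).
    apply: ler_wpM2l; first by rewrite exprn_ge0// subr_ge0.
    apply: (@le_trans _ _ (1 + (cutoff_exponent c n)%:R * y ^+ n)); last first.
      by apply: bernoulli_ge; lra.
    rewrite -natr1 addrC lerD2l.
    have /andP[h _] := mP n.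
    apply: le_trans (ler_wpM2r yn0 h); rewrite -mulrA ler_peMr//.
    by rewrite mulrC ler_pdivlMr ?exprn_gt0// mul1r lerXn2r// nnegrE ltW.
  rewrite -exprMn exprn_ile1//.
    by rewrite mulr_ge0 ?subr_ge0// addr_ge0.
  by rewrite -subr_sqr expr1n lerBlDr lerDl sqr_ge0.
- exact: cvg_cst.
- by apply: cvg_harmonic.
Unshelve. all: by end_near. Qed.

End bernoulli.

Section moment_problem.
Context d (T : measurableType d) (R : realType) (P : probability T R).
Variables (X : T -> R) (f : R -> R) (b : R).
Notation leb := (@lebesgue_measure R).
Hypothesis mX : measurable_fun setT X.
Hypothesis X_itv : forall w, 0 <= X w < b.
Hypothesis mf : measurable_fun setT f.
Hypothesis f_ge0 : forall x, 0 <= f x.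
Hypothesis f_supp : forall x, ~~ (0 <= x < b) -> f x = 0.
Hypothesis moments : forall n,
  (\int[P]_w (X w ^+ n)%:E = \int[leb]_x (x ^+ n * f x)%:E)%E.

Let b_gt0 : 0 < b.
Proof.
have : exists w : T, True.
  apply/not_existsP => noT; have := @probability_setT _ _ _ P.
  rewrite (_ : [set: T] = set0) ?measure0; last first.
    by apply/seteqP; split=> w //; have := noT w.
  by move/eqP; rewrite eq_sym onee_eq0.
by move=> [w _]; have /andP[] := X_itv w; exact: le_lt_trans.
Qed.

Let xf_ge0 n x : 0 <= x ^+ n * f x.
Proof.
have [/andP[x0 _]|xb] := boolP (0 <= x < b); last by rewrite f_supp// mulr0.
by rewrite mulr_ge0// exprn_ge0.
Qed.

Let mxf n : measurable_fun setT (fun x : R => x ^+ n * f x).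
Proof. by apply: measurable_funM => //; exact: measurable_funX. Qed.

Let intX n : P.-integrable setT (fun w => (X w ^+ n)%:E).
Proof.
apply: (@measurable_bounded_integrable _ _ _ P (fun w => X w ^+ n)) => //.
- by rewrite -ge0_fin_numE// fin_num_measure.
- exact: measurable_funX.
- exists (b ^+ n); split; first by rewrite num_real.
  move=> M bM w _ /=; apply: le_trans (ltW bM).
  have /andP[x0 xb] := X_itv w.
  by rewrite ger0_norm ?exprn_ge0// lerXn2r// ?nnegrE// ltW.
Qed.

Let intxf n : leb.-integrable setT (fun x => (x ^+ n * f x)%:E).
Proof.
apply/integrableP; split; first by apply/measurable_EFinP; exact: mxf.
under eq_integral do rewrite gee0_abs ?lee_fin//.
rewrite -moments; exact: integrable_lty (intX n).
Qed.

Let poly_moments (p : {poly R}) :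
  (\int[P]_w (p.[X w])%:E = \int[leb]_x (p.[x] * f x)%:E)%E.
Proof.
under eq_integral do rewrite horner_coef -sumEFin.
rewrite integral_sum//; last first.
  by move=> i; apply: (@eq_integrable _ _ _ P _ measurableT (fun w => (p`_i)%:E * (X w ^+ i)%:E)%E) => //; exact: integrableZl.
under [RHS]eq_integral do rewrite horner_coef mulr_suml -sumEFin.
rewrite integral_sum//; last first.
  move=> i; apply: (@eq_integrable _ _ _ leb _ measurableT (fun x => (p`_i)%:E * (x ^+ i * f x)%:E)%E) => //.
    by move=> x _; rewrite -EFinM mulrA.
  exact: integrableZl.
apply: eq_bigr => i _.
under eq_integral do rewrite EFinM.
under [RHS]eq_integral do rewrite -mulrA EFinM.
by rewrite !integralZl// moments.
Qed.

(** The cutoff polynomials, rescaled to [[0, b)], approximate the indicator of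
    [x < c] boundedly, so dominated convergence on both sides carries the equality
    of moments over to distribution functions. *)
Let cdf c : 0 < c < b ->
  (P [set w | (X w < c)%R] = \int[leb]_(x in `]-oo, c[) (f x)%:E)%E.
Proof.
move=> /andP[c0 cb].
have cb01 : 0 < c / b < 1 by rewrite divr_gt0//= ltr_pdivrMr// mul1r.
pose u n (x : R) := (1 - (x / b) ^+ n) ^+ cutoff_exponent (c / b) n.
pose pu n : {poly R} := (1 - (b^-1 ^+ n) *: 'X^n) ^+ cutoff_exponent (c / b) n.
have puE n x : (pu n).[x] = u n x.
  by rewrite /pu /u horner_exp !hornerE exprMn [X in 1 - X]mulrC.
have xb x : 0 <= x < b -> 0 <= x / b <= 1.
  by move=> /andP[x0 xb]; rewrite divr_ge0 ?(ltW b_gt0)//= ler_pdivrMr// mul1r ltW.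
have u01 n x : 0 <= x < b -> 0 <= u n x <= 1.
  move=> /xb /andP[x0 x1]; rewrite /u.
  have y0 : 0 <= (x / b) ^+ n by rewrite exprn_ge0.
  have y1 : (x / b) ^+ n <= 1 by rewrite exprn_ile1.
  by rewrite exprn_ge0/= ?subr_ge0// exprn_ile1// ?subr_ge0// lerBlDr lerDl.
have ucvg x : 0 <= x < b -> u n x @[n --> \oo] --> ((x < c)%R%:R : R).
  move=> xb0; rewrite -(ltr_pM2r (_ : 0 < b^-1)) ?invr_gt0//.
  exact: cvg_cutoff (xb _ xb0).
have mu_ n : measurable_fun setT (u n).
  apply: measurable_funX; apply: measurable_funB => //.
  by apply: measurable_funX; exact: measurable_funM.
have cvgP : (\int[P]_w (u n (X w))%:E @[n --> \oo] --> \int[P]_w ((X w < c)%R%:R)%:E)%E.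
  have [] := @dominated_convergence _ _ _ P setT measurableT
     (fun n w => (u n (X w))%:E) (fun w => ((X w < c)%R%:R)%:E) (cst 1%E).
  - by move=> n; apply/measurable_EFinP; exact: measurableT_comp.
  - by apply: measurable_lt_indic.
  - by apply/aeW => w _; apply/cvg_EFin; [exact: nearW|exact: ucvg].
  - exact: finite_measure_integrable_cst.
  - apply/aeW => w n _; rewrite /= lee_fin.
    by have /andP[h0 h1] := u01 n _ (X_itv w); rewrite ger0_norm.
  - by [].
have cvgf : (\int[leb]_x (u n x * f x)%:E @[n --> \oo] --> \int[leb]_x ((x < c)%R%:R * f x)%:E)%E.
  have [] := @dominated_convergence _ _ _ leb setT measurableT
     (fun n x => (u n x * f x)%:E) (fun x => ((x < c)%R%:R * f x)%:E) (EFin \o f).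
  - by move=> n; apply/measurable_EFinP; apply: measurable_funM; [exact: mu_|exact: mf].
  - apply/measurable_EFinP; apply: measurable_funM; last exact: mf.
    by apply/measurable_EFinP; apply: measurable_lt_indic.
  - apply/aeW => x _; apply/cvg_EFin; first exact: nearW.
    have [xb0|xb0] := boolP (0 <= x < b).
      by apply: cvgM; [exact: ucvg|exact: cvg_cst].
    rewrite f_supp// mulr0 (_ : _ \o _ = fun=> 0); first exact: cvg_cst.
    by apply/funext => n /=; rewrite mulr0.
  - have := intxf 0; apply: eq_integrable => // x _.
    by rewrite expr0 mul1r.
  - apply/aeW => x n _; rewrite /= lee_fin.
    have [xb0|xb0] := boolP (0 <= x < b); last by rewrite f_supp// mulr0 normr0.
    have /andP[h0 h1] := u01 n _ xb0.
    by rewrite ger0_norm ?mulr_ge0// ler_piMl.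
  - by [].
have -> : P [set w | (X w < c)%R] = (\int[P]_w ((X w < c)%R%:R)%:E)%E.
  have mXc : measurable [set w | (X w < c)%R].
    rewrite -[X in measurable X]setTI; exact: (measurable_fun_ltr mX (measurable_cst c)).
  have := integral_indic P measurableT mXc; rewrite setIT => h.
  transitivity (\int[P]_w (\1_[set w | (X w < c)%R] w)%:E)%E; first exact: esym.
  by apply: eq_integral => w _; rewrite indicE mem_setE.
have -> : (\int[leb]_(x in `]-oo, c[) (f x)%:E = \int[leb]_x ((x < c)%R%:R * f x)%:E)%E.
  rewrite integral_mkcond; apply: eq_integral => x _; rewrite patchE mem_setE in_itv/=.
  by case: ifP; rewrite ?mul1r ?mul0r.
apply: (cvg_unique _ cvgP); first exact: ereal_hausdorff.
move: cvgf; apply: cvg_trans; apply: near_eq_cvg; apply: nearW => n.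
transitivity (\int[P]_w ((pu n).[X w])%:E)%E.
  by rewrite poly_moments; apply: eq_integral => x _; rewrite puE.
by apply: eq_integral => w _; rewrite puE.
Qed.

Let density_total : (\int[leb]_x (f x)%:E = 1)%E.
Proof.
have := moments 0; rewrite (_ : (\int[P]_w _)%E = 1%E) => [->|].
  by apply: eq_integral => x _; rewrite expr0 mul1r.
rewrite (eq_integral (cst 1%E)) => [|w _]; last by rewrite expr0.
by rewrite integral_cst// mul1e; exact: probability_setT.
Qed.

Let cdfT c : (P [set w | (X w < c)%R] = \int[leb]_(x in `]-oo, c[) (f x)%:E)%E.
Proof.
have [c0|c0] := leP c 0.
  rewrite (_ : [set w | _] = set0) ?measure0; last first.
    apply/seteqP; split=> w //= Xc; have /andP[X0 _] := X_itv w.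
    by move: (lt_le_trans Xc c0); rewrite ltNge X0.
  rewrite integral0_eq// => x; rewrite /= in_itv/= => xc.
  by rewrite f_supp// negb_and -ltNge (lt_le_trans xc c0).
have [bc|cb] := leP b c; last by rewrite cdf// c0.
rewrite (_ : [set w | _] = setT); last first.
  apply/seteqP; split=> w //= _; have /andP[_ Xb] := X_itv w.
  exact: lt_le_trans Xb bc.
rewrite probability_setT -density_total [RHS]integral_mkcond.
apply: eq_integral => x _; rewrite patchE; case: ifPn => //.
rewrite mem_setE in_itv/= -leNgt => cx.
by rewrite f_supp// negb_and -[X in _ || X]leNgt (le_trans bc cx) orbT.
Qed.

Lemma density_of_moments (A : set R) : measurable A ->
  (P (X @^-1` A) = \int[leb]_(x in A) (f x)%:E)%E.
Proof.
pose nu (B : set (measurableTypeR R)) := (\int[leb]_(x in B) (f x)%:E)%E.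
have nu0 : nu set0 = 0%E by exact: integral_set0.
have nu_ge0 B : (0 <= nu B)%E by apply: integral_ge0 => x _; rewrite lee_fin.
have nu_sigma : semi_sigma_additive nu.
  move=> F mF tF mUF; rewrite /nu ge0_integral_bigcup//; last 2 first.
  - by apply: measurable_funTS; apply/measurable_EFinP; exact: mf.
  - by move=> x _; rewrite lee_fin.
  by apply: is_cvg_ereal_nneg_natsum_cond => n _ _; exact: nu_ge0.
pose nuM := isMeasure.Build _ _ _ nu nu0 nu_ge0 nu_sigma.
pose nuS : {measure set (measurableTypeR R) -> \bar R} := HB.pack nu nuM.
pose XM : {mfun T >-> measurableTypeR R} := HB.pack X (@isMeasurableFun.Build _ _ T (measurableTypeR R) X mX).
move=> mA.
apply: (@measure_unique _ R (measurableTypeR R) (@RGenInftyO.G R)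
  (fun n => `]-oo, n%:R[%classic) _ _ _ _ (pushforward P XM) nuS) => //.
- exact: RGenInftyO.measurableE.
- move=> _ _ [x ->] [y ->]; exists (Num.min x y).
  by apply/seteqP; split=> z /=; rewrite !in_itv/= lt_min => /andP.
- by move=> n; exists n%:R.
- apply/seteqP; split=> x //= _; exists (Num.bound `|x : R|) => //=.
  by rewrite in_itv/=; exact: le_lt_trans (ler_norm (x : R)) (archi_boundP (normr_ge0 _)).
- move=> _ [x ->]; rewrite /pushforward -[RHS]cdfT; congr (P _).
- move=> n; rewrite /pushforward; apply: le_lt_trans (ltry 1%R).
  by apply: probability_le1; rewrite -[X in measurable X]setTI; exact: mX.
Qed.

End moment_problem.

(** * Powers of an affine function, and tails of integrable functions *)

Section power_singularity.
Context (R : realType) (a th : R).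
Hypotheses (a_gt0 : 0 < a) (th_gt0 : 0 < th).
Notation leb := (@lebesgue_measure R).

Lemma affine_gt0 x : (0 < 1 - th * x) = (x < th^-1).
Proof. by rewrite subr_gt0 -ltr_pdivlMl// mulr1. Qed.

Lemma affine_ge0 x : (0 <= 1 - th * x) = (x <= th^-1).
Proof. by rewrite subr_ge0 -ler_pdivlMl// mulr1. Qed.

Lemma is_derive_powR_affine (s x : R) : x < th^-1 ->
  is_derive x (1 : R) (fun y => (1 - th * y) `^ s)
    (s * (1 - th * x) `^ (s - 1) * (- th)).
Proof.
move=> xb; have h0 : 0 < 1 + (- th) * x by rewrite mulNr affine_gt0.
have dA := is_derive_affine 1 (- th) x.
have dP := is_derive1_powR s h0.
have := @is_derive1_comp _ (@powR R ^~ s) (fun u => 1 + - th * u) x _ _ dP dA.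
rewrite mulNr (_ : _ \o _ = fun y => (1 - th * y) `^ s)//.
by apply/funext => y /=; rewrite mulNr.
Qed.

Lemma powR_affine_continuous s x : x < th^-1 ->
  {for x, continuous (fun y => (1 - th * y) `^ s)}.
Proof. by move=> xb; apply: is_derive_continuous; exact: is_derive_powR_affine. Qed.

Lemma powR_affine_measurable s D : measurable_fun D (fun y : R => (1 - th * y) `^ s).
Proof.
apply: measurable_funTS; apply: (measurableT_comp (measurable_powR s)).
by apply: measurable_funB => //; exact: measurable_funM.
Qed.

Let F x : R := - (a * th)^-1 * (1 - th * x) `^ a.

Let dF x : x < th^-1 -> is_derive x (1 : R) F ((1 - th * x) `^ (a - 1)).
Proof.
move=> xb; apply: (is_derive_eq (is_deriveZ _ (is_derive_powR_affine a xb))).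
rewrite /GRing.scale/= mulrN mulNr mulrN opprK mulrAC mulrA mulVf ?mul1r//.
by rewrite mulf_neq0// gt_eqF.
Qed.

(** For [a < 1] the integrand is unbounded at the right end, so the fundamental
    theorem of calculus is applied on [[c, dn n]] and [dn n] tends to that end. *)
Lemma integral_power_singularity (c : R) : c <= th^-1 ->
  integral leb `[c, th^-1] (fun x => ((1 - th * x) `^ (a - 1))%:E) =
  ((a * th)^-1 * (1 - th * c) `^ a)%:E.
Proof.
set b := th^-1; rewrite le_eqVlt => /predU1P[->|cb].
  rewrite set_itv1 integral_set1 divff ?gt_eqF// subrr powR0 ?gt_eqF//.
  by rewrite mulr0.
pose dn n : R := b - (b - c) / n.+2%:R.
have bc0 : 0 < b - c by rewrite subr_gt0.
have dnb n : dn n < b by rewrite /dn ltrBlDr ltrDl divr_gt0.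
have cdn n : c < dn n.
  rewrite /dn ltrBrDr -ltrBrDl ltr_pdivrMr// ltr_pMr//.
  by rewrite ltr1n.
have bU : `[c, b[%classic = \bigcup_n `[c, dn n]%classic.
  apply/seteqP; split=> x /=.
    rewrite in_itv/= => /andP[cx xb].
    have xb0 : 0 < b - x by rewrite subr_gt0.
    exists (Num.bound ((b - c) / (b - x))) => //=.
    rewrite in_itv/= cx/= /dn lerBrDr -lerBrDl ler_pdivrMr// -ler_pdivrMl//.
    rewrite mulrC; apply/ltW; apply: lt_le_trans (archi_boundP _) _.
      by rewrite divr_ge0// ltW.
    by rewrite ler_nat; apply: leq_trans (leqnSn _) (leqnSn _).
  by case=> n _ /=; rewrite !in_itv/= => /andP[-> h]; apply: le_lt_trans h (dnb n).
have cf x : x < b -> {for x, continuous (fun y => (1 - th * y) `^ (a - 1))}.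
  exact: powR_affine_continuous.
have mf n : measurable_fun `[c, dn n] (fun y => (1 - th * y) `^ (a - 1)).
  exact: powR_affine_measurable.
pose f x : \bar R := ((1 - th * x) `^ (a - 1))%:E.
rewrite -/f.
have In n : (\int[leb]_(x in `[c, dn n]) f x = (F (dn n))%:E - (F c)%:E)%E.
  apply: continuous_FTC2 => //.
  - apply: continuous_in_subspaceT => x; rewrite inE/= in_itv/= => /andP[_ xd].
    by apply: cf; exact: le_lt_trans xd (dnb n).
  - split.
    + move=> x; rewrite in_itv/= => /andP[_ xd].
      by have [] := dF (lt_trans xd (dnb n)).
    + by apply: cvg_at_right_filter; apply: is_derive_continuous; exact: dF.
    + by apply: cvg_at_left_filter; apply: is_derive_continuous; exact: dF.
  - move=> x; rewrite in_itv/= => /andP[_ xd].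
    by rewrite derive1E; have [] := dF (lt_trans xd (dnb n)).
have Fdn : F (dn n) @[n --> \oo] --> (0 : R).
  rewrite -[X in _ --> X](mulr0 (- (a * th)^-1)); apply: cvgM; first exact: cvg_cst.
  have /cvg_at_rightP := @powR_cvg0 R a a_gt0; apply; split.
    by move=> n; rewrite affine_gt0.
  have -> : (fun n => 1 - th * dn n) = (fun n => th * (b - c) * harmonic n.+1).
    apply/funext => n; rewrite /dn /= mulrBr mulfV ?gt_eqF//.
    by rewrite opprB addrC subrK mulrA.
  rewrite -[X in _ --> X](mulr0 (th * (b - c))).
  apply: cvgM; first exact: cvg_cst.
  by rewrite (cvg_shiftS (@harmonic R)); exact: cvg_harmonic.
rewrite -integral_itv_bndo_bndc; last by apply/measurable_EFinP; exact: powR_affine_measurable.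
rewrite bU.
have : (\int[leb]_(x in `[c, dn i]) f x @[i --> \oo] -->
   \int[leb]_(x in \bigcup_i `[c, dn i]%classic) f x)%E.
  apply: ge0_nondecreasing_set_cvg_integral => //.
  - move=> i j ij; apply/subsetPset => x /=; rewrite !in_itv/= => /andP[-> /=].
    move=> /le_trans; apply; rewrite /dn lerD2l lerN2 ler_pM2l// lef_pV2 ?posrE//.
    by rewrite ler_nat.
  - by move=> i; apply/measurable_EFinP; exact: mf.
  - by move=> i x _; rewrite lee_fin powR_ge0.
under eq_cvg do rewrite In.
move=> /cvg_unique; apply; first exact: ereal_hausdorff.
rewrite (_ : ((a * th)^-1 * _)%:E = 0%:E - (F c)%:E)%E; last first.
  by rewrite -EFinB sub0r /F mulNr opprK.
have : (F (dn n) - F c)%:E @[n --> \oo] --> (0 - F c)%:E.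
  apply/cvg_EFin; first exact: nearW.
  by apply: cvgB => //; exact: cvg_cst.
by [].
Qed.

Lemma power_singularity_integrable (c : R) :
  leb.-integrable `[c, th^-1] (EFin \o (fun x => (1 - th * x) `^ (a - 1))).
Proof.
have [cb|bc] := leP c th^-1; last first.
  by rewrite set_itv_ge ?bnd_simp -?ltNge//; exact: integrable_set0.
apply/integrableP; split.
  by apply/measurable_EFinP; exact: powR_affine_measurable.
under eq_integral do rewrite /= ger0_norm ?powR_ge0//.
by have := integral_power_singularity cb; rewrite /= => ->; rewrite ltry.
Qed.

End power_singularity.

Section tails.
Context (R : realType).
Notation leb := (@lebesgue_measure R).
Implicit Types (f : R -> R) (b c x y : R).

Lemma tail_split f b c y : leb.-integrable `[c, b] (EFin \o f) ->
  c <= y -> y <= b ->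
  \int[leb]_(t in `[y, b]) f t =
  \int[leb]_(t in `[c, b]) f t - \int[leb]_(t in `[c, y]) f t.
Proof.
move=> intf cy yb; rewrite Rintegral_itvB ?bnd_simp//.
rewrite Rintegral_itv_obnd_cbnd//; apply: integrableS intf => //.
by apply: subset_itv; rewrite bnd_simp.
Qed.

Lemma tail_split_middle f b c y : leb.-integrable `[c, b] (EFin \o f) ->
  c <= y -> y <= b ->
  \int[leb]_(t in `[c, b]) f t =
  \int[leb]_(t in `[c, y]) f t + \int[leb]_(t in `[y, b]) f t.
Proof. by move=> intf cy yb; rewrite (tail_split intf cy yb) addrC subrK. Qed.

Lemma tail_eq0 f b y : b <= y -> \int[leb]_(t in `[y, b]) f t = 0.
Proof.
rewrite le_eqVlt => /predU1P[->|yb]; first by rewrite set_itv1 Rintegral_set1.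
by rewrite set_itv_ge ?bnd_simp -?ltNge// Rintegral_set0.
Qed.

(** Continuity of the integral in its lower bound needs no continuity of [f]. The
    cut-off [f'] extends [f] by [0] beyond [b], which places every [x > c], even
    one not below [b], in the interior of the interval of integration. *)
Lemma tail_continuous f b c x : leb.-integrable `[c, b] (EFin \o f) -> c < x ->
  {for x, continuous (fun y => \int[leb]_(t in `[y, b]) f t)}.
Proof.
move=> intf cx; pose u := Num.max x b + 1.
have xu : x < u by rewrite /u ltr_pwDr// le_max lexx.
have bu : b < u by rewrite /u ltr_pwDr// le_max lexx orbT.
pose f' := f \_ `[c, b].
have intf' : leb.-integrable `[c, u] (EFin \o f').
  rewrite -restrict_EFin; apply/integrable_restrict => //=.
  apply: (@integrableS _ _ _ leb `[c, b]%classic _ (EFin \o f)) => //.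
  exact: measurableI.
have /(continuous_within_itvP _ (lt_trans cx xu))[cF _ _] :=
  parameterized_integral_continuous (ltW (lt_trans cx xu)) intf'.
pose F y := parameterized_integral leb c y f'.
have TE y : c <= y -> y <= u -> \int[leb]_(t in `[y, b]) f t = F u - F y.
  move=> cy yu; rewrite /F /parameterized_integral -(tail_split intf')//.
  rewrite [RHS]Rintegral_mkcond [LHS]Rintegral_mkcond; congr Rintegral.
  apply/funext => t; rewrite !patchE !mem_setE !in_itv/=.
  case: (leP y t) => //= yt; case: (leP t b) => [tb|bt]/=.
    by rewrite (le_trans tb (ltW bu)) /f' patchE mem_setE in_itv/= (le_trans cy yt) tb.
  by case: ifP => // _; rewrite /f' patchE mem_setE in_itv/= [t <= b]leNgt bt andbF.
have cT : {for x, continuous (fun y => F u - F y)}.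
  apply: continuousB; first exact: cst_continuous.
  by apply: cF; rewrite in_itv/= cx.
rewrite /prop_for /continuous_at (TE _ (ltW cx) (ltW xu)).
apply: cvg_trans cT; apply: near_eq_cvg; near=> y.
rewrite TE//; apply/ltW; near: y; first exact: lt_nbhsr.
exact: lt_nbhsl.
Unshelve. all: by end_near. Qed.

Lemma is_derive_tail f b c x : leb.-integrable `[c, b] (EFin \o f) -> c < x < b ->
  {for x, continuous f} ->
  is_derive x (1 : R) (fun y => \int[leb]_(t in `[y, b]) f t) (- f x).
Proof.
move=> intf /andP[cx xb] cf.
have [dF F'] := continuous_FTC1_closed xb intf cx cf.
apply: (@near_eq_is_derive _ _ _ (fun y => \int[leb]_(t in `[c, b]) f t - \int[leb]_(t in `[c, y]) f t)).
  near=> y.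
  have cy : c <= y by apply/ltW; near: y; exact: lt_nbhsr.
  have yb : y <= b by apply/ltW; near: y; exact: lt_nbhsl.
  by rewrite (tail_split intf cy yb).
rewrite -[X in is_derive _ _ _ X]sub0r; apply: is_deriveB.
by rewrite -F' derive1E; exact: derivableP.
Unshelve. all: by end_near. Qed.

End tails.

(** * From an equation for the tails to a recursion for the moments *)

Section moments_from_tails.
Context (R : realType) (g : R -> R).
Hypotheses (mg : measurable_fun setT g) (g_ge0 : forall x, 0 <= g x).
Notation leb := (@lebesgue_measure R).

Let monomial_continuous n : continuous (fun x : R => n.+1%:R * x ^+ n).
Proof.
by move=> x; apply: cvgM; [exact: cvg_cst|exact: exprn_continuous].
Qed.

Let monomial_measurable n (D : set R) :
  measurable_fun D (fun x : R => (n.+1%:R * x ^+ n)%:E : \bar R).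
Proof.
apply: measurable_funTS; apply/measurable_EFinP.
exact: continuous_measurable_fun (@monomial_continuous n).
Qed.

Lemma integral_monomial n (y : R) : 0 < y ->
  (\int[leb]_(x in `]0%R, y]) (n.+1%:R * x ^+ n)%:E = (y ^+ n.+1)%:E)%E.
Proof.
move=> y0.
rewrite integral_itv_obnd_cbnd; last exact: monomial_measurable.
rewrite (@continuous_FTC2 _ _ (fun x : R => x ^+ n.+1) _ _ y0).
- by rewrite expr0n/= sube0.
- exact/continuous_subspaceT/monomial_continuous.
- split.
  + by move=> x _; exact: exprn_derivable.
  + exact/cvg_at_right_filter/exprn_continuous.
  + exact/cvg_at_left_filter/exprn_continuous.
- by move=> x _; rewrite derive1E exp_derive/= /GRing.scale/= mulr1.
Qed.

(** Exchanging the integrals, the inner integral of [n.+1 * x ^ n] runs over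
    [0 < x <= c * u]. The absolute value in [F] keeps the integrand nonnegative
    for all [x]. *)
Lemma weighted_tail_integral n (c : R) : 0 < c ->
  (forall x, x <= 0 -> g x = 0) ->
  (\int[leb]_(x in `]0%R, +oo[) ((n.+1%:R * x ^+ n)%:E *
      \int[leb]_(u in `[(c^-1 * x)%R, +oo[) (g u)%:E) =
   \int[leb]_u ((c * u) ^+ n.+1 * g u)%:E)%E.
Proof.
move=> c0 g0.
pose F (z : measurableTypeR R * measurableTypeR R) : \bar R :=
  ((0 < z.1)%R%:R%:E * (n.+1%:R * `|z.1| ^+ n)%:E * ((c^-1 * z.1 <= z.2)%R%:R%:E * (g z.2)%:E))%E.
have F0 z : (0 <= F z)%E by rewrite /F !mule_ge0// lee_fin// mulr_ge0// exprn_ge0.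
have mw : measurable_fun setT (fun x : measurableTypeR R => n.+1%:R * `|x| ^+ n).
  apply: continuous_measurable_fun => x; apply: cvgM; first exact: cvg_cst.
  apply: (@continuous_comp _ _ _ (fun y : R => `|y|) (fun y : R => y ^+ n)).
    exact: norm_continuous.
  exact: exprn_continuous.
have mF : measurable_fun setT F.
  apply: emeasurable_funM; apply: emeasurable_funM.
  - exact: measurable_lt_indic.
  - apply/measurable_EFinP; exact: (measurableT_comp mw).
  - by apply: measurable_le_indic => //; apply: measurable_funM.
  - apply/measurable_EFinP; exact: (measurableT_comp mg).
transitivity (\int[leb]_x \int[leb]_u F (x, u))%E.
  rewrite integral_mkcond; apply: eq_integral => x _.
  rewrite patchE mem_setE in_itv/= andbT /F/=; case: ifPn => [x0|_]; last first.
    by rewrite integral0_eq// => u _; rewrite mul0e mul0e.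
  rewrite tail_integralE mul1e gtr0_norm// ge0_integralZl//.
  - apply: emeasurable_funM; first exact: measurable_le_indic.
    exact/measurable_EFinP.
  - by move=> u _; rewrite mule_ge0// lee_fin.
  - by rewrite lee_fin mulr_ge0// exprn_ge0// ltW.
rewrite (@fubini_tonelli _ _ _ _ _ leb leb F)//.
apply: eq_integral => u _; rewrite /F/=.
have [u0|u0] := leP u 0.
  by rewrite g0// mulr0 integral0_eq// => x _; rewrite !mule0.
have cu0 : 0 < c * u by rewrite mulr_gt0.
transitivity ((\int[leb]_(x in `]0%R, (c * u)%R]) (n.+1%:R * x ^+ n)%:E) * (g u)%:E)%E; last first.
  by rewrite integral_monomial// EFinM.
rewrite -ge0_integralZr//; first last.
- by rewrite lee_fin.
- by move=> x /=; rewrite in_itv/= => /andP[x0 _]; rewrite lee_fin mulr_ge0// exprn_ge0// ltW.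
- exact: monomial_measurable.
rewrite [RHS]integral_mkcond; apply: eq_integral => x _.
rewrite patchE mem_setE in_itv/= ler_pdivrMl//.
case: ltP => x0 /=; last by rewrite !mul0e.
case: ifP => _; last by rewrite mul0e mule0.
by rewrite !mul1e gtr0_norm.
Qed.

Variable b : R.
Hypotheses (b_gt0 : 0 < b) (g_supp : forall x, ~~ (0 < x <= b) -> g x = 0).
Hypothesis g_fin : (\int[leb]_x (g x)%:E < +oo)%E.

Definition moment n := fine (\int[leb]_x (x ^+ n * g x)%:E)%E.

Let monomial_g_ge0 n x : 0 <= x ^+ n * g x.
Proof.
have [/andP[x0 _]|/g_supp->] := boolP (0 < x <= b); last by rewrite mulr0.
by rewrite mulr_ge0// exprn_ge0// ltW.
Qed.

Let monomial_g_measurable n : measurable_fun setT (fun x : R => (x ^+ n * g x)%:E : \bar R).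
Proof.
by apply/measurable_EFinP; exact: measurable_funM.
Qed.

Lemma momentE n : (\int[leb]_x (x ^+ n * g x)%:E = (moment n)%:E)%E.
Proof.
rewrite /moment fineK// ge0_fin_numE; last first.
  by apply: integral_ge0 => x _; rewrite lee_fin.
apply: (@le_lt_trans _ _ (\int[leb]_x ((b ^+ n)%:E * (g x)%:E))%E).
  apply: ge0_le_integral => //.
  - by move=> x _; rewrite lee_fin.
  - exact: monomial_g_measurable.
  - by apply: emeasurable_funM => //; apply/measurable_EFinP.
  move=> x _; rewrite lee_fin.
  have [/andP[x0 xb]|/g_supp->] := boolP (0 < x <= b); last by rewrite !mulr0.
  by rewrite ler_wpM2r// lerXn2r ?nnegrE// ltW.
rewrite ge0_integralZl//.
- by rewrite lte_mul_pinfty// lee_fin exprn_ge0// ltW.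
- exact/measurable_EFinP.
- by move=> x _; rewrite lee_fin.
- by rewrite lee_fin exprn_ge0// ltW.
Qed.

Variables (m lam r q : R) (p : nat -> R).
Hypotheses (m_ge0 : 0 <= m) (lam_ge0 : 0 <= lam) (r_ge0 : 0 <= r) (q01 : 0 < q < 1).
Hypothesis p_ge0 : forall k, 0 <= p k.

Let tail (x : R) : \bar R := (\int[leb]_(u in `[x, +oo[) (g u)%:E)%E.

Hypothesis equation : forall x, 0 < x ->
  ((g x)%:E + lam%:E * \sum_(k <oo) (p k.+1)%:E * tail (q ^- k.+1 * x)%R =
   (m * x * g x)%:E + (lam * r)%:E * tail x)%E.

(** The equation is multiplied by [n.+1 * x ^ n] and integrated over [x > 0];
    by [weighted_tail_integral], the tail scaled by [q ^- k] contributes the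
    moment of order [n.+1] multiplied by [(q ^+ k) ^+ n.+1]. *)
Lemma moment_recursion n s :
  (\sum_(k <oo) (p k.+1 * (q ^+ k.+1) ^+ n.+1)%:E = s%:E)%E ->
  n.+1%:R * moment n = (n.+1%:R * m + lam * (r - s)) * moment n.+1.
Proof.
move=> sE.
have g0 x : x <= 0 -> g x = 0 by move=> x0; rewrite g_supp// ltNge x0.
have q0 : 0 < q by case/andP: q01.
pose w x : R := n.+1%:R * x ^+ n.
have w_ge0 x : `]0%R, +oo[%classic x -> 0 <= w x.
  by rewrite /= in_itv/= andbT => x0; rewrite mulr_ge0// exprn_ge0// ltW.
have mw (D : set R) : measurable_fun D (fun x : R => (w x)%:E : \bar R).
  exact: monomial_measurable.
have tail_ge0 x : (0 <= tail x)%E by apply: integral_ge0 => u _; rewrite lee_fin.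
have mtail c : measurable_fun setT (fun x : R => tail (c * x)).
  have -> : (fun x : R => tail (c * x)) = (fun x : measurableTypeR R =>
      \int[leb]_u (((c * x <= u)%R%:R)%:E * (g u)%:E))%E.
    by apply/funext => x; rewrite /tail tail_integralE.
  apply: (@measurable_fun_fubini_tonelli_F _ _ _ _ _ leb
    (fun z : measurableTypeR R * measurableTypeR R =>
      ((c * z.1 <= z.2)%R%:R%:E * (g z.2)%:E)%E)).
    2: by move=> z; rewrite mule_ge0// lee_fin.
  apply: emeasurable_funM; first by apply: measurable_le_indic => //; apply: measurable_funM.
  apply/measurable_EFinP; exact: (measurableT_comp mg).
have mtailA c (A : set R) : measurable_fun A (fun x : R => tail (c * x)).
  by apply: measurable_funTS; exact: mtail.
have mgT : measurable_fun setT (fun x : R => (g x)%:E : \bar R).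
  exact/measurable_EFinP.
pose D : set R := `]0%R, +oo[%classic.
have mD : measurable D by exact: measurable_itv.
have moment_half k : (\int[leb]_(x in D) (x ^+ k * g x)%:E = (moment k)%:E)%E.
  rewrite integral_mkcond -momentE; apply: eq_integral => x _.
  rewrite patchE mem_setE in_itv/= andbT; case: ltP => // x0.
  by rewrite g0// mulr0.
have tail_half k : (\int[leb]_(x in D) ((w x)%:E * tail (q ^- k * x)%R) =
    ((q ^+ k) ^+ n.+1 * moment n.+1)%:E)%E.
  rewrite weighted_tail_integral// ?exprn_gt0//.
  under eq_integral do rewrite exprMn -mulrA EFinM.
  rewrite ge0_integralZl//; first by rewrite momentE.
  - exact: monomial_g_measurable.
  - by move=> x _; rewrite lee_fin.
  - by rewrite lee_fin !exprn_ge0// ltW.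
pose f k x := ((p k.+1)%:E * tail (q ^- k.+1 * x)%R)%E.
have f_ge0 k x : (0 <= f k x)%E by rewrite mule_ge0// lee_fin.
have mf k (A : set R) : measurable_fun A (f k).
  by apply: measurable_funTS; apply: emeasurable_funM => //; exact: measurable_cst.
have mf_sum (A : set R) : measurable_fun A (fun x => \sum_(k <oo) f k x)%E.
  by apply: measurable_funTS; exact: ge0_emeasurable_sum.
have f_sum_ge0 x : (0 <= \sum_(k <oo) f k x)%E by exact: nneseries_ge0.
have w_series : (\int[leb]_(x in D) ((w x)%:E * \sum_(k <oo) f k x) =
    (s * moment n.+1)%:E)%E.
  transitivity (\int[leb]_(x in D) \sum_(k <oo) ((w x)%:E * f k x))%E.
    by apply: eq_integral => x /[!inE] xD; rewrite nneseriesZl.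
  rewrite integral_nneseries//; first last.
  - by move=> k x xD; rewrite mule_ge0// lee_fin w_ge0.
  - by move=> k; apply: emeasurable_funM; [exact: mw|exact: mf].
  rewrite mulrC EFinM -sE -nneseriesZl//; last first.
    by move=> k _; rewrite lee_fin mulr_ge0// !exprn_ge0// ltW.
  apply: eq_eseriesr => k _.
  under eq_integral do rewrite muleCA.
  rewrite ge0_integralZl ?lee_fin//.
  - by rewrite tail_half -!EFinM; congr _%:E; ring.
  - by apply: emeasurable_funM; [exact: mw|exact: mtailA].
  - by move=> x xD; rewrite mule_ge0// lee_fin w_ge0.
have lhs : (\int[leb]_(x in D) ((w x)%:E * ((g x)%:E + lam%:E * \sum_(k <oo) f k x)) =
    (n.+1%:R * moment n + lam * (s * moment n.+1))%:E)%E.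
  transitivity (\int[leb]_(x in D) ((n.+1%:R)%:E * (x ^+ n * g x)%:E +
      lam%:E * ((w x)%:E * \sum_(k <oo) f k x)))%E.
    apply: eq_integral => x /[!inE] xD.
    rewrite ge0_muleDr ?lee_fin ?mule_ge0 ?lee_fin//.
    by rewrite [(_ * (lam%:E * _))%E]muleCA -!EFinM mulrA.
  rewrite ge0_integralD//.
  - rewrite !ge0_integralZl ?lee_fin//.
    + by rewrite moment_half w_series.
    + by apply: emeasurable_funM; [exact: mw|exact: mf_sum].
    + by move=> x xD; rewrite mule_ge0// lee_fin w_ge0.
    + by apply: measurable_funTS; exact: monomial_g_measurable.
    + by move=> x _; rewrite lee_fin.
  - by move=> x _; rewrite mule_ge0// lee_fin.
  - apply: emeasurable_funM; first exact: measurable_cst.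
    by apply: measurable_funTS; exact: monomial_g_measurable.
  - by move=> x xD; rewrite !mule_ge0// ?lee_fin// w_ge0.
  - apply: emeasurable_funM; first exact: measurable_cst.
    by apply: emeasurable_funM; [exact: mw|exact: mf_sum].
have rhs : (\int[leb]_(x in D) ((w x)%:E * ((m * x * g x)%:E + (lam * r)%:E * tail x)) =
    (n.+1%:R * m * moment n.+1 + lam * r * moment n.+1)%:E)%E.
  transitivity (\int[leb]_(x in D) ((n.+1%:R * m)%:E * (x ^+ n.+1 * g x)%:E +
      (lam * r)%:E * ((w x)%:E * tail (q ^- 0 * x)%R)))%E.
    apply: eq_integral => x /[!inE] xD.
    have x0 : 0 <= x by move: xD; rewrite /D/= in_itv/= andbT => /ltW.
    rewrite ge0_muleDr ?lee_fin ?mule_ge0 ?mulr_ge0 ?lee_fin ?mulr_ge0//.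
    rewrite expr0 invr1 mul1r muleCA -!EFinM; congr (_%:E + _)%E.
    by rewrite /w exprS; ring.
  rewrite ge0_integralD//.
  - rewrite !ge0_integralZl ?lee_fin ?mulr_ge0//.
    + by rewrite moment_half tail_half expr0 expr1n mul1r.
    + by apply: emeasurable_funM; [exact: mw|exact: mtailA].
    + by move=> x xD; rewrite mule_ge0// lee_fin w_ge0.
    + by apply: measurable_funTS; exact: monomial_g_measurable.
    + by move=> x _; rewrite lee_fin.
  - by move=> x _; rewrite mule_ge0// lee_fin// mulr_ge0.
  - apply: emeasurable_funM; first exact: measurable_cst.
    by apply: measurable_funTS; exact: monomial_g_measurable.
  - by move=> x xD; apply: mule_ge0; [rewrite lee_fin mulr_ge0|rewrite mule_ge0// lee_fin w_ge0].
  - apply: emeasurable_funM; first exact: measurable_cst.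
    by apply: emeasurable_funM; [exact: mw|exact: mtailA].
have : (n.+1%:R * moment n + lam * (s * moment n.+1))%:E =
    (n.+1%:R * m * moment n.+1 + lam * r * moment n.+1)%:E.
  rewrite -lhs -rhs; apply: eq_integral => x /[!inE]/=; rewrite /D/= in_itv/= andbT => x0.
  by rewrite -(equation x0).
move=> [e]; have {}e := e; lra.
Qed.

End moments_from_tails.

(** * The recurrence and the function glued from its pieces *)

Section finite_sums.
Context (R : realType) (I : eqType).
Implicit Types (s : seq I) (f : I -> R -> R).

Lemma continuous_sum_seq s f (x : R) :
  (forall i, i \in s -> {for x, continuous (f i)}) ->
  {for x, continuous (fun y => \sum_(i <- s) f i y)}.
Proof.
elim: s => [_|i s IH cf].
  under [X in {for x, continuous X}]eq_fun do rewrite big_nil.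
  exact: cst_continuous.
under [X in {for x, continuous X}]eq_fun do rewrite big_cons.
apply: continuousD; first by apply: cf; rewrite mem_head.
by apply: IH => j js; apply: cf; rewrite in_cons js orbT.
Qed.

Lemma is_derive_sum_seq s f (df : I -> R) (x : R) :
  (forall i, i \in s -> is_derive x (1 : R) (f i) (df i)) ->
  is_derive x (1 : R) (fun y => \sum_(i <- s) f i y) (\sum_(i <- s) df i).
Proof.
elim: s => [_|i s IH cf].
  under [X in is_derive _ _ X]eq_fun do rewrite big_nil.
  by rewrite big_nil; exact: is_derive_cst.
under [X in is_derive _ _ X]eq_fun do rewrite big_cons.
rewrite big_cons; apply: is_deriveD; first by apply: cf; rewrite mem_head.
by apply: IH => j js; apply: cf; rewrite in_cons js orbT.
Qed.

End finite_sums.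

Section existence.
Context (R : realType) (q m lam r : R) (p : nat -> R).

Let step (h : nat -> R -> R) (j : nat) (x : R) : R :=
  (1 - m * x) `^ (lam * r / m - 1) *
  ((1 - q ^+ j) `^ (1 - lam * r / m) * h j.-1 (q ^+ j / m)
   - lam * \sum_(1 <= k < j.+1) q ^- k * p k *
       \int[lebesgue_measure]_(y in `[x, q ^+ j / m]) h_integrand q m lam r h j k y).

(** The recurrence defines [h j] from all the [h (j - k)], which is not a
    structural recursion. Stage [n] is the whole family, correct up to index [n]. *)
Fixpoint h_stage (n j : nat) (x : R) : R :=
  if n is n'.+1 then if (j <= n')%N then h_stage n' j x else step (h_stage n') j x
  else (1 - m * x) `^ (lam * r / m - 1).

Lemma h_stage_stable n j : (j <= n)%N -> h_stage n j = h_stage j j.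
Proof.
elim: n => [|n IH]; first by rewrite leqn0 => /eqP->.
rewrite leq_eqVlt => /predU1P[->//|]; rewrite ltnS => jn.
by rewrite -IH//; apply/funext => x; rewrite /= jn.
Qed.

Lemma h_recurrence_exists : exists h, h_recurrence q m lam r p h.
Proof.
exists (fun j => h_stage j j); split=> // -[//|j] x _ _.
rewrite [LHS]/= ltnn /step; congr (_ * (_ - lam * _)).
apply: eq_big_nat => k /andP[k1 kj]; congr (_ * _).
apply: eq_Rintegral => y _; rewrite /h_integrand h_stage_stable//.
by rewrite leq_subLR; case: k k1 {kj} => // k _; rewrite addSn ltnS leq_addl.
Qed.

End existence.

(** The candidate density is [glued] divided by the normalizing constant. *)
Definition glued (R : realType) (q m : R) (h : nat -> R -> R) (x : R) : R :=
  limn (series (fun j : nat => if q ^+ j.+1 / m < x <= q ^+ j / m then h j x else 0)).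

Section recurrence_regularity.
Context (R : realType) (q m lam r : R) (p : nat -> R) (h : nat -> R -> R).
Hypotheses (q01 : 0 < q < 1) (m_gt0 : 0 < m) (lam_gt0 : 0 < lam) (r_gt0 : 0 < r).
Hypothesis hrec : h_recurrence q m lam r p h.
Notation leb := (@lebesgue_measure R).

Let a := lam * r / m.
Let b (j : nat) := q ^+ j / m.

Let q_gt0 : 0 < q. Proof. by case/andP: q01. Qed.
Let q_lt1 : q < 1. Proof. by case/andP: q01. Qed.
Let a_gt0 : 0 < a. Proof. by rewrite divr_gt0// mulr_gt0. Qed.
Let aM : a * m = lam * r. Proof. by rewrite /a divfK// gt_eqF. Qed.
Let b_gt0 j : 0 < b j. Proof. by rewrite divr_gt0// exprn_gt0. Qed.
Let b0E : b 0 = m^-1. Proof. by rewrite /b expr0 mul1r. Qed.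

Let bS_lt j : b j.+1 < b j.
Proof. by rewrite /b exprS -mulrA gtr_pMl// b_gt0. Qed.

Let b_le i j : (i <= j)%N -> b j <= b i.
Proof.
elim: j => [|j IH]; first by rewrite leqn0 => /eqP->.
rewrite leq_eqVlt => /predU1P[->//|]; rewrite ltnS => /IH.
exact: le_trans (ltW (bS_lt j)).
Qed.

Let b_shift j k : (k <= j)%N -> q ^- k * b j = b (j - k).
Proof.
move=> kj; rewrite /b mulrA -{1}(subnK kj) exprD (mulrC (q ^+ (j - k))) mulrA.
by rewrite mulVf ?mul1r// expf_neq0// gt_eqF.
Qed.

Let scale_le j k y : (k <= j)%N -> (q ^- k * y <= b (j - k)) = (y <= b j).
Proof. by move=> kj; rewrite -(b_shift kj) ler_pM2l// invr_gt0 exprn_gt0. Qed.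

Let scale_lt j k y : (k <= j)%N -> (q ^- k * y < b (j - k)) = (y < b j).
Proof. by move=> kj; rewrite -(b_shift kj) ltr_pM2l// invr_gt0 exprn_gt0. Qed.

(** Continuity of [h j] up to and including the right end of its domain, to the
    right of which its values are arbitrary. It fails for [h 0], which can be
    unbounded there. *)
Let continuous_version (j : nat) : Prop :=
  exists2 g : R -> R, continuous g & forall x, x <= b j -> h j x = g x.

Let h0E x : x <= b 0 -> h 0 x = (1 - m * x) `^ (a - 1).
Proof. by rewrite b0E; exact: hrec.1. Qed.

Let hi := h_integrand q m lam r h.

(** The power of [1 - m * x], extended continuously beyond [b 1], which stays away
    from the singularity at [b 0]. *)
Let cut s (x : R) : R := (1 - m * Num.min x (b 1)) `^ s.

Let cut_continuous s : continuous (cut s).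
Proof.
move=> x; apply: (@continuous_comp _ _ _ (fun x => Num.min x (b 1)) (fun y => (1 - m * y) `^ s)).
  by apply: continuous_min; [exact: cvg_id|exact: cst_continuous].
apply: powR_affine_continuous => //; rewrite -b0E.
by rewrite (le_lt_trans _ (bS_lt 0))// ge_min lexx orbT.
Qed.

Let cutE s x : x <= b 1 -> cut s x = (1 - m * x) `^ s.
Proof. by move=> xb; rewrite /cut min_l. Qed.

Let h0_scaled_integrable j c : leb.-integrable `[c, b j] (EFin \o (fun y => h 0 (q ^- j * y))).
Proof.
have th0 : 0 < m * q ^- j by rewrite mulr_gt0// invr_gt0 exprn_gt0.
have := power_singularity_integrable a_gt0 th0 c.
have -> : (m * q ^- j)^-1 = b j by rewrite invfM invrK mulrC.
apply: eq_integrable => // y; rewrite inE/= in_itv/= => /andP[_ yb].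
by rewrite h0E ?mulrA// -(subnn j) scale_le.
Qed.

(** For [k < j] the integrand is continuous up to the right end. For [k = j] it
    contains [h 0], with an integrable singularity at [b j], multiplied by a
    bounded factor. *)
Let integrand_integrable j k c : (1 <= k <= j)%N ->
  ((k < j)%N -> continuous_version (j - k)) ->
  leb.-integrable `[c, b j] (EFin \o hi j k).
Proof.
move=> /andP[k1 kj] cv.
have bj1 : b j <= b 1 by rewrite b_le// (leq_trans k1 kj).
have [jk|] := leqP j k.
  have {kj jk} kj : k = j by apply/eqP; rewrite eqn_leq kj.
  subst k.
  apply: (@eq_integrable _ _ _ leb `[c, b j]%classic _
      ((EFin \o cut (- a)) \* (EFin \o (fun y => h 0 (q ^- j * y))))%E) => //.
    move=> y; rewrite inE/= in_itv/= => /andP[_ yb].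
    by rewrite /hi /h_integrand subnn cutE ?(le_trans yb)// EFinM.
  apply: integrableMr => //.
  - have mc : measurable_fun setT (cut (- a)).
      by apply: continuous_measurable_fun; exact: cut_continuous.
    exact: measurable_funTS mc.
  - exists ((1 - q) `^ (- a)); split; first by rewrite num_real.
    move=> M hM y _ /=; apply: le_trans (ltW hM).
    have q1 : 0 < 1 - q by rewrite subr_gt0.
    have qy : 1 - q <= 1 - m * Num.min y (b 1).
      rewrite lerD2l lerN2 -ler_pdivlMl// mulrC.
      by rewrite (_ : q / m = b 1) ?ge_min ?lexx ?orbT// /b expr1.
    have q2 : 0 < 1 - m * Num.min y (b 1) by exact: lt_le_trans qy.
    rewrite ger0_norm ?powR_ge0// /cut !powRN lef_pV2 ?posrE ?powR_gt0//.
    by apply: ge0_ler_powR => //; rewrite ?nnegrE; exact/ltW.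
move=> /cv[g cg hg].
apply: (@eq_integrable _ _ _ leb `[c, b j]%classic _ (EFin \o (fun y => cut (- a) y * g (q ^- k * y)))) => //.
  move=> y; rewrite inE/= in_itv/= => /andP[_ yb].
  by rewrite /hi /h_integrand cutE ?(le_trans yb)// hg// scale_le.
apply: continuous_compact_integrable; first exact: segment_compact.
apply: continuous_subspaceT => y; apply: continuousM; first exact: cut_continuous.
apply: (@continuous_comp _ _ _ (fun y => q ^- k * y) g); last exact: cg.
by apply: continuousM; [exact: cst_continuous|exact: cvg_id].
Qed.

Let tail_sum j (x : R) : R :=
  \sum_(1 <= k < j.+1) q ^- k * p k * \int[leb]_(y in `[x, b j]) hi j k y.

Let hE j x : (0 < j)%N -> x <= b j ->
  h j x = (1 - m * x) `^ (a - 1) *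
    ((1 - q ^+ j) `^ (1 - a) * h j.-1 (b j) - lam * tail_sum j x).
Proof. by move=> j0 xb; rewrite hrec.2// h0E// (le_trans xb)// b_le. Qed.

Let tail_sum_continuous j :
  (forall k, (0 < k < j)%N -> continuous_version k) -> continuous (tail_sum j).
Proof.
move=> cv x; rewrite /tail_sum.
apply: continuous_sum_seq => k; rewrite mem_index_iota ltnS => /andP[k1 kj].
apply: continuousM; first exact: cst_continuous.
apply: (@tail_continuous _ _ _ (x - 1)); last by rewrite ltrBlDr ltrDl.
apply: integrand_integrable; first by rewrite k1.
move=> jk; apply: cv; rewrite subn_gt0 jk/=.
by rewrite ltn_subrL k1 (leq_trans _ jk).
Qed.

Let h_continuous_version j : (0 < j)%N -> continuous_version j.
Proof.
elim/ltn_ind: j => j IH j0.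
have cv k : (0 < k < j)%N -> continuous_version k.
  by move=> /andP[k0 kj]; exact: IH.
exists (fun x => cut (a - 1) x *
    ((1 - q ^+ j) `^ (1 - a) * h j.-1 (b j) - lam * tail_sum j x)).
  move=> x; apply: continuousM; first exact: cut_continuous.
  apply: continuousB; first exact: cst_continuous.
  by apply: continuousM; [exact: cst_continuous|exact: tail_sum_continuous].
by move=> x xb; rewrite hE// cutE// (le_trans xb)// b_le.
Qed.

Lemma h_integrand_integrable j k c : (1 <= k <= j)%N ->
  leb.-integrable `[c, b j] (EFin \o hi j k).
Proof.
move=> kj; apply: integrand_integrable => // jk.
by apply: h_continuous_version; rewrite subn_gt0.
Qed.

Lemma h_integrable j c : leb.-integrable `[c, b j] (EFin \o h j).
Proof.
case: j => [|j].
  have := power_singularity_integrable a_gt0 m_gt0 c; rewrite -b0E.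
  apply: eq_integrable => // x; rewrite inE/= in_itv/= => /andP[_ xb].
  by rewrite h0E.
have [g cg hg] := h_continuous_version (ltn0Sn j).
apply: (@eq_integrable _ _ _ leb `[c, b j.+1]%classic _ (EFin \o g)) => //.
  by move=> x; rewrite inE/= in_itv/= => /andP[_ xb]; rewrite hg.
apply: continuous_compact_integrable; first exact: segment_compact.
exact: continuous_subspaceT.
Qed.

Lemma h_continuous j x : x < b j -> {for x, continuous (h j)}.
Proof.
case: j => [|j] xb.
  have := @powR_affine_continuous _ m m_gt0 (a - 1) x; rewrite -b0E => /(_ xb) cf.
  rewrite /prop_for /continuous_at h0E ?(ltW xb)//.
  apply: cvg_trans cf; apply: near_eq_cvg; near=> y; rewrite h0E//.
  by apply/ltW; near: y; exact: lt_nbhsl.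
have [g cg hg] := h_continuous_version (ltn0Sn j).
rewrite /prop_for /continuous_at hg ?(ltW xb)//.
apply: cvg_trans (cg x); apply: near_eq_cvg; near=> y; rewrite hg//.
by apply/ltW; near: y; exact: lt_nbhsl.
Unshelve. all: by end_near. Qed.

Lemma h_left_continuous j : (0 < j)%N -> h j x @[x --> (b j)^'-] --> h j (b j).
Proof.
move=> /h_continuous_version[g cg hg]; rewrite hg//.
apply: cvg_trans (cvg_at_left_filter (cg (b j))).
by apply: near_eq_cvg; near=> y; rewrite hg.
Unshelve. all: by end_near. Qed.

(** All the integrals in the recurrence vanish at the right end of the domain,
    and the power of [1 - q ^+ j] cancels that of [1 - m * b j]: this factor is
    there to make the glued function continuous. *)
Lemma h_glue j : h j.+1 (b j.+1) = h j (b j.+1).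
Proof.
rewrite hE// /tail_sum big1 => [|k _]; last first.
  by rewrite tail_eq0 ?mulr0.
rewrite mulr0 subr0 mulrA (_ : m * b j.+1 = q ^+ j.+1); last first.
  by rewrite /b mulrC divfK// gt_eqF.
rewrite -(opprB a 1) powRN mulfV ?mul1r//.
by rewrite gt_eqF// powR_gt0// subr_gt0 exprn_ilt1 ?(ltW q_gt0).
Qed.

Let g := glued q m h.

Let piece_uniq i j x : b i.+1 < x <= b i -> b j.+1 < x <= b j -> i = j.
Proof.
move=> /andP[i1 i2] /andP[j1 j2]; apply/eqP; rewrite eqn_leq; apply/andP; split.
  rewrite leqNgt; apply/negP => /b_le ji.
  by have := lt_le_trans (lt_le_trans j1 i2) ji; rewrite ltxx.
rewrite leqNgt; apply/negP => /b_le ij.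
by have := lt_le_trans (lt_le_trans i1 j2) ij; rewrite ltxx.
Qed.

Let b_cvg0 : b n @[n --> \oo] --> (0 : R).
Proof.
rewrite -[X in _ --> X](mul0r m^-1); apply: cvgM; last exact: cvg_cst.
by apply: cvg_expr; rewrite ger0_norm// ltW.
Qed.

Let piece_exists x : 0 < x <= b 0 -> exists j, b j.+1 < x <= b j.
Proof.
move=> /andP[x0 xb].
have exN : exists n, b n < x.
  have : \forall n \near \oo, b n < x.
    have /cvgrPdist_lt/(_ x x0) := b_cvg0; apply: filterS => n.
    by rewrite sub0r normrN gtr0_norm.
  by move=> [n _ /(_ n (leqnn n))]; exists n.
case: (ex_minnP exN) => -[|j]; first by rewrite ltNge xb.
move=> bj /(_ j) h'; exists j; rewrite bj/= leNgt; apply/negP => /h'.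
by rewrite ltnn.
Qed.

Lemma glued_piece j x : b j.+1 < x <= b j -> g x = h j x.
Proof.
move=> xj; rewrite /g /glued; apply: lim_near_cst => //.
near=> n; rewrite /series/= (bigD1_seq j)//= ?iota_uniq//; last first.
  by rewrite mem_index_iota/=; near: n; exact: nbhs_infty_gt.
rewrite -/(b j.+1) -/(b j) xj big1 ?addr0// => i ij.
case: ifP => // xi; have := piece_uniq xi xj.
by move/eqP; rewrite (negPf ij).
Unshelve. all: by end_near. Qed.

Lemma glued_eq0 x : ~~ (0 < x <= b 0) -> g x = 0.
Proof.
move=> xN; rewrite /g /glued; apply: lim_near_cst => //; apply: nearW => n.
rewrite /series/= big1// => i _; case: ifP => // /andP[h1 h2].
move: xN; rewrite (lt_trans (b_gt0 _) h1)/= => /negP; case.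
exact: le_trans h2 (b_le (leq0n i)).
Qed.

Lemma glued_closed_piece j x : b j.+1 <= x <= b j -> g x = h j x.
Proof.
move=> /andP[]; rewrite le_eqVlt => /predU1P[<-|bx] xb; last first.
  by apply: glued_piece; rewrite bx xb.
by rewrite (@glued_piece j.+1) ?bS_lt ?lexx// h_glue.
Qed.

Lemma glued_continuous x : 0 < x < b 0 -> {for x, continuous g}.
Proof.
move=> /andP[x0 xb0].
have [|j /andP[jx]] := @piece_exists x; first by rewrite x0 ltW.
rewrite le_eqVlt => /predU1P[xE|xb]; last first.
  rewrite /prop_for /continuous_at (@glued_piece j) ?jx ?ltW//.
  apply: cvg_trans (h_continuous xb); apply: near_eq_cvg; near=> y.
  rewrite (@glued_piece j)//; apply/andP; split; first by near: y; exact: lt_nbhsr.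
  by apply/ltW; near: y; exact: lt_nbhsl.
case: j jx xE => [|j] jx xE; first by rewrite xE ltxx in xb0.
rewrite /prop_for; apply/left_right_continuousP; split.
  rewrite xE (@glued_closed_piece j.+1) ?lexx ?(ltW (bS_lt _))//.
  apply: cvg_trans (h_left_continuous (ltn0Sn j)); apply: near_eq_cvg.
  near=> y; rewrite (@glued_piece j.+1)//; apply/andP; split.
    near: y; exact: nbhs_left_gt (bS_lt _).
  by apply/ltW; near: y; exact: nbhs_left_lt.
rewrite xE (@glued_closed_piece j) ?lexx ?(ltW (bS_lt _))//.
apply: cvg_trans (cvg_at_right_filter (h_continuous (bS_lt j))); apply: near_eq_cvg.
near=> y; rewrite (@glued_piece j)//; apply/andP; split.
  by near: y; exact: nbhs_right_gt.
by near: y; exact: nbhs_right_le (bS_lt _).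
Unshelve. all: by end_near. Qed.

Lemma glued_integrable c : 0 < c -> leb.-integrable `[c, b 0] (EFin \o g).
Proof.
move=> c0; have int1 : leb.-integrable `[b 1, b 0] (EFin \o g).
  apply: eq_integrable (h_integrable 0 (b 1)) => // x; rewrite inE/= in_itv/= => xb.
  by rewrite (@glued_closed_piece 0).
have [bc|cb] := leP (b 1) c.
  by apply: integrableS int1 => //; apply: subset_itvr; rewrite bnd_simp.
have int2 : leb.-integrable `[c, b 1] (EFin \o g).
  apply: continuous_compact_integrable; first exact: segment_compact.
  apply: continuous_in_subspaceT => x; rewrite inE/= in_itv/= => /andP[cx xb].
  by apply: glued_continuous; rewrite (lt_le_trans c0 cx) (le_lt_trans xb (bS_lt 0)).
have int1' : leb.-integrable `]b 1, b 0] (EFin \o g).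
  by apply: integrableS int1 => //; apply: subset_itvr; rewrite bnd_simp.
have cU : `[c, b 0]%classic = `[c, b 1]%classic `|` `]b 1, b 0]%classic.
  by rewrite -itv_bndbnd_setU// bnd_simp ltW// ltW.
have mg : measurable_fun `[c, b 0] (EFin \o g).
  rewrite cU; apply/measurable_funU => //.
  by split; [have /integrableP[] := int2|have /integrableP[] := int1'].
apply/integrableP; split=> //; rewrite cU ge0_integral_setU//.
- by rewrite lte_add_pinfty//; [have /integrableP[] := int2|have /integrableP[] := int1'].
- by rewrite -cU; exact: measurableT_comp.
- apply/disj_set2P/seteqP; split=> // x /=; rewrite !in_itv/= => -[/andP[_ h1] /andP[h2 _]].
  by move: (lt_le_trans h2 h1); rewrite ltxx.
Qed.

Let G x := \int[leb]_(t in `[x, b 0]) g t.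

Lemma tail_glued_continuous x : 0 < x -> {for x, continuous G}.
Proof.
move=> x0; have x20 : 0 < x / 2 by rewrite divr_gt0.
apply: (tail_continuous (glued_integrable x20)).
by rewrite ltr_pdivrMr// ltr_pMr// ltr1n.
Qed.

Lemma is_derive_tail_glued x : 0 < x < b 0 -> is_derive x (1 : R) G (- g x).
Proof.
move=> xb; have /andP[x0 xb0] := xb; have x20 : 0 < x / 2 by rewrite divr_gt0.
apply: (is_derive_tail (glued_integrable x20)); last exact: glued_continuous.
by rewrite xb0 andbT ltr_pdivrMr// ltr_pMr// ltr1n.
Qed.

Let scaled_gt0 k x : 0 < x -> 0 < q ^- k * x.
Proof. by move=> x0; rewrite mulr_gt0// invr_gt0 exprn_gt0. Qed.

Let rhs j x := lam * (r * G x - \sum_(1 <= k < j.+1) p k * G (q ^- k * x)).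

Let rhs_continuous j x : 0 < x -> {for x, continuous (rhs j)}.
Proof.
move=> x0; apply: continuousM; first exact: cst_continuous.
apply: continuousB.
  by apply: continuousM; [exact: cst_continuous|exact: tail_glued_continuous].
apply: continuous_sum_seq => k _; apply: continuousM; first exact: cst_continuous.
apply: (@continuous_comp _ _ _ (fun x => q ^- k * x) G).
  by apply: continuousM; [exact: cst_continuous|exact: cvg_id].
exact/tail_glued_continuous/scaled_gt0.
Qed.

Let scaled_piece j k y : (k <= j)%N -> b j.+1 < y < b j ->
  b (j - k).+1 < q ^- k * y < b (j - k).
Proof.
move=> kj /andP[y1 y2]; rewrite scale_lt// y2 andbT -subSn//.
by rewrite -b_shift ?leqW// ltr_pM2l// invr_gt0 exprn_gt0.
Qed.

Let is_derive_rhs j y : b j.+1 < y < b j ->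
  is_derive y (1 : R) (rhs j)
    (lam * (\sum_(1 <= k < j.+1) q ^- k * p k * h (j - k) (q ^- k * y) - r * h j y)).
Proof.
move=> yb; have /andP[y1 y2] := yb.
have y0 : 0 < y := lt_trans (b_gt0 _) y1.
have dG : is_derive y (1 : R) G (- h j y).
  rewrite -(@glued_piece j) ?y1 ?(ltW y2)//; apply: is_derive_tail_glued.
  by rewrite y0 (lt_le_trans y2)// b_le.
have dS : is_derive y (1 : R) (fun x => \sum_(1 <= k < j.+1) p k * G (q ^- k * x))
    (\sum_(1 <= k < j.+1) p k * (- h (j - k) (q ^- k * y) * q ^- k)).
  apply: is_derive_sum_seq => k; rewrite mem_index_iota ltnS => /andP[k1 kj].
  apply: (is_deriveZ (p k)).
  have /andP[s1 s2] := scaled_piece kj yb.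
  have dGk : is_derive (q ^- k * y) (1 : R) G (- h (j - k) (q ^- k * y)).
    rewrite -(@glued_piece (j - k)) ?s1 ?(ltW s2)//; apply: is_derive_tail_glued.
    by rewrite scaled_gt0//= (lt_le_trans s2)// b_le.
  have dL := is_derive_affine 0 (q ^- k) y.
  rewrite (_ : (fun u => 0 + q ^- k * u) = (fun u => q ^- k * u)) in dL; last first.
    by apply/funext => u; rewrite add0r.
  exact: (@is_derive1_comp _ G (fun u => q ^- k * u) y _ _ dGk dL).
apply: (is_derive_eq (is_deriveZ lam (is_deriveB (is_deriveZ r dG) dS))).
rewrite /GRing.scale/= mulrN addrC; congr (_ * (_ - _)).
rewrite -sumrN; apply: eq_bigr => k _; ring.
Qed.

Let affine_continuous y : {for y, continuous (fun x => 1 - m * x)}.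
Proof.
apply: continuousB; first exact: cst_continuous.
by apply: continuousM; [exact: cst_continuous|exact: cvg_id].
Qed.

Let lhs j x := (1 - m * x) * h j x.

Let is_derive_lhs j y : (0 < j)%N -> b j.+1 < y < b j ->
  is_derive y (1 : R) (lhs j)
    (lam * (\sum_(1 <= k < j.+1) q ^- k * p k * h (j - k) (q ^- k * y) - r * h j y)).
Proof.
move=> j0 /andP[y1 y2].
have yb0 : y < m^-1 by rewrite -b0E (lt_le_trans y2)// b_le.
have my0 : 0 < 1 - m * y by rewrite affine_gt0.
pose K := (1 - q ^+ j) `^ (1 - a) * h j.-1 (b j).
have dS : is_derive y (1 : R) (tail_sum j)
    (\sum_(1 <= k < j.+1) q ^- k * p k * (- hi j k y)).
  apply: is_derive_sum_seq => k; rewrite mem_index_iota ltnS => /andP[k1 kj].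
  apply: (is_deriveZ (q ^- k * p k)).
  apply: (@is_derive_tail _ _ _ (y - 1)).
  - by apply: h_integrand_integrable; rewrite k1.
  - by rewrite y2 andbT ltrBlDr ltrDl.
  - apply: continuousM; first exact: powR_affine_continuous.
    apply: (@continuous_comp _ _ _ (fun y => q ^- k * y) (h (j - k))).
      by apply: continuousM; [exact: cst_continuous|exact: cvg_id].
    by apply: h_continuous; rewrite scale_lt.
have dP := is_derive_powR_affine m_gt0 a yb0.
apply: (@near_eq_is_derive _ _ _ (fun x => (1 - m * x) `^ a * (K - lam * tail_sum j x))).
  near=> x.
  have xb : x <= b j by apply/ltW; near: x; exact: lt_nbhsl.
  have mx0 : 0 <= 1 - m * x by rewrite affine_ge0// -b0E (le_trans xb)// b_le.
  by rewrite /lhs hE// mulrA mulr_powRB1.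
apply: (is_derive_eq (is_deriveM dP (is_deriveB (is_derive_cst K y 1) (is_deriveZ lam dS)))).
rewrite /GRing.scale/= hE ?(ltW y2)// -/K sub0r mulrBr; congr (_ + _).
  have E : - (lam * (\sum_(1 <= k < j.+1) q ^- k * p k * - hi j k y)) =
      lam * \sum_(1 <= k < j.+1) q ^- k * p k * hi j k y.
    by rewrite -mulrN -sumrN; congr (_ * _); apply: eq_bigr => k _; rewrite mulrN opprK.
  transitivity ((1 - m * y) `^ a * (lam * \sum_(1 <= k < j.+1) q ^- k * p k * hi j k y)).
    by congr (_ * _); exact: E.
  rewrite mulrCA mulr_sumr; congr (_ * _); apply: eq_bigr => k _.
  have A0 : (1 - m * y) `^ a != 0 by rewrite gt_eqF// powR_gt0.
  rewrite /hi /h_integrand -/a powRN; field.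
  by rewrite A0 gt_eqF// exprn_gt0.
transitivity ((K - lam * tail_sum j y) * (a * (1 - m * y) `^ (a - 1) * - m)) => //.
transitivity (- (a * m * ((1 - m * y) `^ (a - 1) * (K - lam * tail_sum j y)))); first by ring.
by rewrite aM; ring.
Unshelve. all: by end_near. Qed.

Hypothesis p_ge0 : forall k, 0 <= p k.
Hypothesis p_sum : forall n, \sum_(1 <= k < n) p k <= r.

Lemma tail_glued_eq0 x : b 0 <= x -> G x = 0.
Proof. exact: tail_eq0. Qed.

(** Both sides have the same derivative on the [j]-th piece: multiplying
    the recurrence by [1 - m * x] turns [h 0] into [(1 - m * x) `^ a], which solves
    the homogeneous equation, and the integrals come from variation of constants. They agree at
    the right end by the equation on the previous piece, where the additional
    term [k = j] vanishes; on the piece [0] both sides are explicit. *)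
Lemma tail_equation_step j x : b j.+1 <= x <= b j ->
  (1 - m * x) * g x = lam * (r * G x - \sum_(1 <= k < j.+1) p k * G (q ^- k * x)).
Proof.
elim: j x => [|j IH] x xj.
  have /andP[_ xb] := xj; have xb' : x <= m^-1 by rewrite -b0E.
  rewrite big_geq// subr0 (@glued_closed_piece 0)// h0E// mulr_powRB1 ?affine_ge0//.
  have GE : G x = (a * m)^-1 * (1 - m * x) `^ a.
    transitivity (fine (integral leb `[x, m^-1] (fun x => ((1 - m * x) `^ (a - 1))%:E))).
      rewrite /G /Rintegral b0E; congr fine; apply: eq_integral => y.
      rewrite inE/= in_itv/= => /andP[xy yb].
      rewrite (@glued_closed_piece 0) ?h0E// b0E// yb andbT.
      by apply: le_trans xy; case/andP: xj.
    by rewrite integral_power_singularity.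
  by rewrite GE aM mulrA mulVKf// mulf_neq0// gt_eqF.
have /andP[x1 x2] := xj.
have x0 : 0 < x := lt_le_trans (b_gt0 _) x1.
pose D y := lhs j.+1 y - rhs j.+1 y.
have Db : D (b j.+1) = 0.
  have := IH (b j.+1); rewrite lexx (ltW (bS_lt j)) => /(_ isT).
  rewrite (@glued_closed_piece j.+1) ?lexx ?(ltW (bS_lt _))// => e.
  rewrite /D /lhs e /rhs [in X in _ - X]big_nat_recr//= b_shift// subnn.
  by rewrite (tail_glued_eq0 (lexx _)) mulr0 addr0 subrr.
suff : D x = 0.
  by move/eqP; rewrite subr_eq0 (@glued_closed_piece j.+1)// => /eqP.
move: x2; rewrite le_eqVlt => /predU1P[->//|x2].
have cD y : x <= y -> y < b j.+1 -> {for y, continuous D}.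
  move=> xy yb; apply: continuousB; last exact/rhs_continuous/(lt_le_trans x0).
  by apply: continuousM; [exact: affine_continuous|exact: h_continuous].
have dD y : y \in `]x, b j.+1[ -> is_derive y (1 : R) D 0.
  rewrite in_itv/= => /andP[xy yb].
  have yj : b j.+2 < y < b j.+1 by rewrite (le_lt_trans x1).
  by apply: (is_derive_eq (is_deriveB (is_derive_lhs _ yj) (is_derive_rhs yj))) => //; rewrite subrr.
have [|c _] := @MVT R D (fun=> 0) _ _ x2 dD.
  apply/(continuous_within_itvP _ x2); split.
  - by move=> y; rewrite in_itv/= => /andP[/ltW xy yb]; exact: cD.
  - exact/cvg_at_right_filter/cD.
  - apply: cvgB; last exact/cvg_at_left_filter/rhs_continuous.
    apply: cvgM; last exact: h_left_continuous.
    exact/cvg_at_left_filter/affine_continuous.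
by rewrite mul0r Db sub0r => /eqP; rewrite oppr_eq0 => /eqP.
Qed.

(** The equation in a form that does not depend on the piece containing [x]:
    the terms with [k > j] vanish there, since [q ^- k * x] is then beyond [b 0]. *)
Lemma tail_equation x : 0 < x <= b 0 -> \forall n \near \oo,
  (1 - m * x) * g x = lam * (r * G x - \sum_(1 <= k < n) p k * G (q ^- k * x)).
Proof.
move=> /piece_exists[j /andP[xj xb]]; near=> n.
rewrite (@tail_equation_step j) ?xb ?(ltW xj)//; congr (_ * (_ - _)).
have jn : (j.+1 <= n)%N by near: n; exact: nbhs_infty_ge.
have tail0 : \sum_(j.+1 <= k < n) p k * G (q ^- k * x) = 0.
  rewrite big_nat_cond big1// => k /andP[/andP[jk _] _].
  rewrite tail_glued_eq0 ?mulr0// -(subnn k) -b_shift//.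
  rewrite ler_pM2l ?invr_gt0 ?exprn_gt0//.
  exact: le_trans (b_le jk) (ltW xj).
by rewrite [RHS](@big_cat_nat _ _ _ j.+1)//= tail0 addr0.
Unshelve. all: by end_near. Qed.

Lemma tail_glued_decreasing s : 0 < s -> (forall x, s < x < b 0 -> 0 < g x) ->
  forall x y, s <= x -> x < y -> x < b 0 -> G y < G x.
Proof.
move=> s0 gpos x y sx xy xb.
have lt_in u v : s <= u -> u < v -> v <= b 0 -> G v < G u.
  move=> su uv vb.
  have [||c] := @MVT R G (fun x => - g x) u v uv.
  - move=> z; rewrite in_itv/= => /andP[uz zv]; apply: is_derive_tail_glued.
    by rewrite (lt_le_trans zv vb) (lt_le_trans s0)// (le_trans su)// ltW.
  - apply: continuous_in_subspaceT => z; rewrite inE/= in_itv/= => /andP[uz _].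
    by apply: tail_glued_continuous; rewrite (lt_le_trans s0)// (le_trans su).
  rewrite in_itv/= => /andP[uc cv] e; rewrite -subr_lt0 e mulNr oppr_lt0 mulr_gt0 ?subr_gt0//.
  by apply: gpos; rewrite (le_lt_trans su uc) (lt_le_trans cv vb).
have [yb|by_] := leP y (b 0); first exact: lt_in.
rewrite (tail_glued_eq0 (ltW by_)) -(tail_glued_eq0 (lexx (b 0))).
exact: lt_in.
Qed.

(** The right-hand side of [tail_equation] is at least
    [lam * r * (G s - G (q^-1 * s))], as [G] is nonincreasing to the right of [s]
    and the sum of the [p k] is at most [r]; and [G] is strictly decreasing
    there. *)
Lemma glued_gt0_extends s : 0 < s < b 0 -> (forall x, s < x < b 0 -> 0 < g x) -> 0 < g s.
Proof.
move=> /andP[s0 sb] gpos.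
have Gdec := tail_glued_decreasing s0 gpos.
have Gle x y : s <= x -> x <= y -> G y <= G x.
  move=> sx; rewrite le_eqVlt => /predU1P[->//|xy].
  have [xb|bx] := ltP x (b 0); first by rewrite ltW// Gdec.
  by rewrite !tail_glued_eq0// (le_trans bx)// ltW.
have sq : s < q^-1 * s by rewrite ltr_pMl// invf_gt1.
have [|n _ /(_ n (leqnn n))] := @tail_equation s; first by rewrite s0 ltW.
have ms : 0 < 1 - m * s by rewrite affine_gt0// -b0E.
move=> e; rewrite -(pmulr_rgt0 _ ms) e mulr_gt0// subr_gt0.
have Gq0 : 0 <= G (q^-1 * s).
  have [qb|bq] := leP (q^-1 * s) (b 0); last by rewrite tail_glued_eq0// ltW.
  by rewrite -(tail_glued_eq0 (lexx (b 0))); apply: Gle => //; exact: ltW.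
apply: (@le_lt_trans _ _ (r * G (q^-1 * s))); last first.
  by rewrite ltr_pM2l// Gdec.
apply: (@le_trans _ _ ((\sum_(1 <= k < n) p k) * G (q^-1 * s))); last exact: ler_wpM2r.
rewrite mulr_suml [leLHS]big_nat_cond [leRHS]big_nat_cond; apply: ler_sum => k /andP[/andP[k1 _] _].
apply: ler_wpM2l => //; apply: Gle; first exact: ltW.
rewrite ler_pM2r// lef_pV2 ?posrE ?exprn_gt0//.
by rewrite -[leRHS]expr1 ler_wiXn2l// ltW.
Qed.

(** The function is positive on the piece [0]. If it were not positive
    everywhere, the supremum [s] of the points where it is nonpositive would be
    at most [b 1]; then it is positive to the right of [s], hence at [s] by
    [glued_gt0_extends], hence near [s] by continuity. *)
Lemma glued_gt0 x : 0 < x < b 0 -> 0 < g x.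
Proof.
move=> x0b; rewrite ltNge; apply/negP => gx.
pose A := [set y | 0 < y < b 0 /\ g y <= 0].
have g1 y : b 1 <= y -> y < b 0 -> 0 < g y.
  move=> y1 y0; rewrite (@glued_closed_piece 0) ?y1 ?ltW// h0E ?ltW// powR_gt0//.
  by rewrite affine_gt0// -b0E.
have Ab y : A y -> y <= b 1.
  move=> [/andP[y0 yb] gy]; rewrite leNgt; apply/negP => /ltW y1.
  by have := lt_le_trans (g1 _ y1 yb) gy; rewrite ltxx.
have supA : has_sup A by split; [exists x|exists (b 1)].
pose s := sup A.
have xs : x <= s by apply: ub_le_sup => //; exists (b 1).
have s0 : 0 < s by case/andP: x0b => x0 _; exact: lt_le_trans xs.
have sb1 : s <= b 1 by apply: ge_sup => //; exists x.
have sb : s < b 0 := le_lt_trans sb1 (bS_lt 0).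
have gpos y : s < y < b 0 -> 0 < g y.
  move=> /andP[sy yb]; rewrite ltNge; apply/negP => gy.
  have /(ub_le_sup _) : A y by split; rewrite // (lt_trans s0 sy).
  move=> /(_ (ex_intro _ (b 1) Ab)); rewrite leNgt => /negP; exact.
have gs : 0 < g s by apply: glued_gt0_extends => //; rewrite s0.
have : \forall y \near s, 0 < g y.
  have cg : {for s, continuous g} by apply: glued_continuous; rewrite s0.
  exact: (cvgr_gt _ cg).
move=> /nbhs_ballP[e /= e0 he].
have [y Ay ys] := sup_adherent e0 supA.
have [_ gy] := Ay.
have : 0 < g y.
  apply: he; rewrite /ball/= ger0_norm ?subr_ge0; last by apply: ub_le_sup => //; exists (b 1).
  by rewrite ltrBlDr -ltrBlDl.
by rewrite ltNge gy.
Qed.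

Lemma glued_ge0 x : 0 <= g x.
Proof.
have [/andP[x0]|xN] := boolP (0 < x <= b 0); last by rewrite glued_eq0.
rewrite le_eqVlt => /predU1P[->|xb]; last by rewrite ltW// glued_gt0// x0.
by rewrite (@glued_closed_piece 0) ?lexx ?(ltW (bS_lt 0))// h0E// powR_ge0.
Qed.

Let G_le x y : 0 < x -> x <= y -> G y <= G x.
Proof.
move=> x0; rewrite le_eqVlt => /predU1P[->//|xy].
have [xb|bx] := ltP x (b 0); last by rewrite !tail_glued_eq0// (le_trans bx)// ltW.
apply: ltW; apply: (tail_glued_decreasing x0) => // z /andP[xz zb].
by apply: glued_gt0; rewrite zb (lt_trans x0 xz).
Qed.

Let G_ge0 x : 0 < x -> 0 <= G x.
Proof.
move=> x0; have [xb|bx] := leP x (b 0); last by rewrite tail_glued_eq0// ltW.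
by rewrite -(tail_glued_eq0 (lexx (b 0))) G_le.
Qed.

(** On [(0, b 1]] the equation gives [g <= K * G], so on an interval of length at
    most [(2 * K)^-1] the tail [G] can at most double. As [K] does not depend on
    [x], one such interval reaches from [x0] down to [0]. *)
Lemma tail_glued_bounded : exists M, forall x, 0 < x -> G x <= M.
Proof.
have q1 : 0 < 1 - q by rewrite subr_gt0.
pose K := lam * r / (1 - q).
have K0 : 0 < K by rewrite divr_gt0// mulr_gt0.
have gK x : 0 < x -> x <= b 1 -> g x <= K * G x.
  move=> x0 xb; have [|n _ /(_ n (leqnn n)) e] := @tail_equation x.
    by rewrite x0 (le_trans xb)// b_le.
  have mx : 1 - q <= 1 - m * x.
    by rewrite lerD2l lerN2 -ler_pdivlMl// mulrC (_ : q / m = b 1)// /b expr1.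
  have : (1 - q) * g x <= lam * (r * G x).
    apply: (@le_trans _ _ ((1 - m * x) * g x)); first by rewrite ler_wpM2r// glued_ge0.
    rewrite e ler_pM2l// lerBlDr lerDl sumr_ge0// => k _.
    by rewrite mulr_ge0// G_ge0// scaled_gt0.
  by rewrite /K mulrAC ler_pdivlMr// mulrA mulrC.
pose x0 := Num.min (b 1) (2 * K)^-1.
have x00 : 0 < x0 by rewrite lt_min b_gt0 invr_gt0 mulr_gt0.
exists (2 * G x0) => x xpos.
have [xx0|x0x] := ltP x x0; last first.
  apply: le_trans (G_le x00 x0x) _.
  by rewrite ler_peMl ?G_ge0// ler1n.
have [||c] := @MVT R G (fun x => - g x) x x0 xx0.
- move=> z; rewrite in_itv/= => /andP[xz zx]; apply: is_derive_tail_glued.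
  rewrite (lt_trans xpos xz) (lt_le_trans zx)// (le_trans (y := b 1)) ?b_le// ge_min lexx //.
- apply: continuous_in_subspaceT => z; rewrite inE/= in_itv/= => /andP[xz _].
  by apply: tail_glued_continuous; exact: lt_le_trans xz.
rewrite in_itv/= => /andP[xc cx0] e.
have c0 : 0 < c := lt_trans xpos xc.
have cb1 : c <= b 1 by rewrite (le_trans (ltW cx0))// ge_min lexx.
have h1 : g c * (x0 - x) <= K * G x * x0.
  apply: ler_pM; rewrite ?glued_ge0// ?subr_ge0 ?(ltW xx0)//.
    by apply: le_trans (gK _ c0 cb1) _; rewrite ler_pM2l// G_le// ltW.
  by rewrite lerBlDr lerDl ltW.
have h2 : K * G x * x0 <= G x / 2.
  rewrite mulrAC mulrC ler_wpM2l ?G_ge0//.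
  have : x0 <= (2 * K)^-1 by rewrite ge_min lexx orbT.
  by move=> /(ler_wpM2l (ltW K0)) /le_trans; apply; rewrite invfM mulrCA mulfV ?mulr1// gt_eqF.
lra.
Qed.

Let piece_bigcup : `]0, b 0]%classic = \bigcup_n `[b n, b 0]%classic.
Proof.
apply/seteqP; split=> x /=.
  rewrite in_itv/= => xb; have [j /andP[xj _]] := piece_exists xb.
  by exists j.+1 => //=; rewrite in_itv/= ltW//; case/andP: xb.
by move=> [n _ /=]; rewrite !in_itv/= => /andP[bx ->]; rewrite (lt_le_trans (b_gt0 n)).
Qed.

Lemma glued_measurable : measurable_fun setT g.
Proof.
have m1 : measurable_fun `]0, b 0] g.
  rewrite piece_bigcup; apply/measurable_fun_bigcup => n //.
  by have /integrableP[/measurable_EFinP] := glued_integrable (b_gt0 n).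
have m2 : measurable_fun (~` `]0, b 0]) g.
  have m0 : measurable_fun (~` `]0, b 0]) (cst (0 : R)) by exact: measurable_cst.
  apply: eq_measurable_fun m0 => x; rewrite inE/= in_itv/= => /negP xN.
  by rewrite glued_eq0.
rewrite -(setUv `]0, b 0]%classic); apply/measurable_funU => //.
exact: measurableC.
Qed.

Lemma series_norm_terms n : series (norm_terms q m h) n = G (b n).
Proof.
elim: n => [|n IH]; first by rewrite /series/= big_geq// tail_glued_eq0.
rewrite /series/= big_nat_recr//= -[X in X + _]/(series (norm_terms q m h) n) IH.
rewrite /G (tail_split_middle (glued_integrable (b_gt0 n.+1)) (ltW (bS_lt n)) (b_le (leq0n n))).
rewrite addrC; congr (_ + _); apply: eq_Rintegral => x; rewrite inE/= in_itv/= => xb.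
by rewrite (@glued_closed_piece n).
Qed.

Lemma norm_terms_cvg : cvgn (series (norm_terms q m h)).
Proof.
have [M HM] := tail_glued_bounded.
apply: nondecreasing_is_cvgn.
  by move=> i j ij; rewrite !series_norm_terms G_le// b_le.
by exists M => _ [n _ <-]; rewrite series_norm_terms HM.
Qed.

Let C := norm_const q m h.

Let GC : G (b n) @[n --> \oo] --> C.
Proof.
have -> : (fun n => G (b n)) = series (norm_terms q m h).
  by apply/funext => n; rewrite series_norm_terms.
exact: norm_terms_cvg.
Qed.

Lemma norm_const_gt0 : 0 < C.
Proof.
have G1 : 0 < G (b 1).
  rewrite -(tail_glued_eq0 (lexx (b 0))).
  apply: (tail_glued_decreasing (b_gt0 1)) => // z /andP[bz zb].
  by apply: glued_gt0; rewrite zb (lt_trans _ bz).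
apply: (lt_le_trans G1); rewrite -(cvg_lim _ GC)//.
apply: limr_ge; first by apply/cvg_ex; exists C; exact: GC.
by near=> n; apply: G_le; rewrite ?b_gt0// b_le//; near: n; exact: nbhs_infty_ge.
Unshelve. all: by end_near. Qed.

Lemma integral_glued : (\int[leb]_x (g x)%:E = C%:E)%E.
Proof.
have -> : (\int[leb]_x (g x)%:E = \int[leb]_(x in `]0%R, b 0]) (g x)%:E)%E.
  rewrite [RHS]integral_mkcond; apply: eq_integral => x _.
  by rewrite patchE mem_setE in_itv/=; case: ifPn => // /glued_eq0 ->.
rewrite piece_bigcup.
have : (\int[leb]_(x in `[b i, b 0]) (g x)%:E @[i --> \oo] -->
   \int[leb]_(x in \bigcup_i `[b i, b 0]%classic) (g x)%:E)%E.
  apply: ge0_nondecreasing_set_cvg_integral => //.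
  - move=> i j ij; apply/subsetPset; apply: subset_itvr; rewrite bnd_simp; exact: b_le.
  - by move=> i; apply/measurable_EFinP; apply: measurable_funTS; exact: glued_measurable.
  - by move=> i x _; rewrite lee_fin glued_ge0.
have e i : (\int[leb]_(x in `[b i, b 0]) (g x)%:E = (G (b i))%:E)%E.
  by rewrite fineK//; apply: integrable_fin_num => //; exact: glued_integrable.
under [X in X @ _]eq_fun do rewrite e.
move=> /cvg_unique; apply; first exact: ereal_hausdorff.
by apply/cvg_EFin; [exact: nearW|exact: GC].
Qed.

End recurrence_regularity.

Lemma nneseriesS (R : realType) (f : nat -> \bar R) :
  (forall k, 0 <= f k)%E ->
  (\sum_(k <oo) f k = f 0%N + \sum_(k <oo) f k.+1)%E.
Proof.
move=> f0; apply: cvg_lim => //; rewrite -cvg_shiftS.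
rewrite (_ : [sequence _]_n =
    (fun n => f 0%N + \sum_(0 <= i < n) f i.+1)%E); last first.
  by apply/funext => n; rewrite /= big_nat_recl.
apply: cvgeD; last exact: is_cvg_nneseries.
  by apply: ge0_adde_def; rewrite inE// nneseries_ge0.
exact: cvg_cst.
Qed.

(** * Moments of the glued function *)

Section glued_moments.
Context (R : realType) (q m lam r : R) (p : nat -> R) (h : nat -> R -> R).
Hypotheses (q01 : 0 < q < 1) (m_gt0 : 0 < m) (lam_gt0 : 0 < lam) (r_gt0 : 0 < r).
Hypothesis hrec : h_recurrence q m lam r p h.
Hypothesis p_ge0 : forall k, 0 <= p k.
Hypothesis p_sum : forall n, \sum_(1 <= k < n) p k <= r.
Notation leb := (@lebesgue_measure R).

Let g := glued q m h.
Let b := q ^+ 0 / m.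
Let b_gt0 : 0 < b. Proof. by rewrite /b expr0 mul1r invr_gt0. Qed.
Let g_ge0 x : 0 <= g x. Proof. exact: (glued_ge0 q01 m_gt0 lam_gt0 r_gt0 hrec p_ge0 p_sum). Qed.
Let mg : measurable_fun setT g. Proof. exact: (glued_measurable q01 m_gt0 lam_gt0 r_gt0 hrec). Qed.
Let g_supp x : ~~ (0 < x <= b) -> g x = 0. Proof. exact: (glued_eq0 h q01 m_gt0). Qed.
Let G x := \int[leb]_(t in `[x, b]) g t.

Let tailE x : 0 < x -> (\int[leb]_(u in `[x, +oo[) (g u)%:E = (G x)%:E)%E.
Proof.
move=> x0.
have <- : (\int[leb]_(u in `[x, b]) (g u)%:E = (G x)%:E)%E.
  rewrite fineK//; apply: integrable_fin_num => //.
  exact: (glued_integrable q01 m_gt0 lam_gt0 r_gt0 hrec x0).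
rewrite integral_mkcond [RHS]integral_mkcond; apply: eq_integral => u _.
rewrite !patchE !mem_setE !in_itv/= andbT; case: (leP x u) => //= xu.
by case: leP => // bu; rewrite g_supp// negb_and -[X in _ || X]ltNge bu orbT.
Qed.

(** Beyond [b] both sides of the equation required by [moment_recursion] vanish;
    below [b] its series has the finite sums of [tail_equation] as its eventually
    constant partial sums. *)
Lemma glued_moment_recursion n s :
  (\sum_(k <oo) (p k.+1 * (q ^+ k.+1) ^+ n.+1)%:E = s%:E)%E ->
  n.+1%:R * moment g n = (n.+1%:R * m + lam * (r - s)) * moment g n.+1.
Proof.
apply: (@moment_recursion _ g mg g_ge0 b b_gt0 g_supp _ m lam r q p); rewrite ?ltW//.
  by rewrite (integral_glued q01 m_gt0 lam_gt0 r_gt0 hrec p_ge0 p_sum) ltry.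
move=> x x0; have q0 : 0 < q by case/andP: q01.
have qx k : 0 < q ^- k * x by rewrite mulr_gt0// invr_gt0 exprn_gt0.
rewrite tailE//.
under eq_eseriesr do rewrite tailE// -EFinM.
have [xb|bx] := leP x b; last first.
  have G0 y : b <= y -> G y = 0 by exact: tail_eq0.
  rewrite G0 ?(ltW bx)// mule0 g_supp; last by rewrite negb_and -[X in _ || X]ltNge bx orbT.
  rewrite mulr0 eseries0 ?mule0// => k _ _; rewrite G0 ?mulr0//.
  rewrite (le_trans (ltW bx))// ler_peMl ?(ltW x0)// invf_ge1 ?exprn_gt0//.
  by rewrite exprn_ile1// ltW//; case/andP: q01.
have := @tail_equation R q m lam r p h q01 m_gt0 lam_gt0 r_gt0 hrec x.
rewrite x0 xb => /(_ isT); rewrite -/g -/b => eqn.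
have -> : (\sum_(k <oo) (p k.+1 * G (q ^- k.+1 * x))%:E =
    (r * G x - (1 - m * x) * g x / lam)%:E)%E.
  apply: lim_near_cst => //; case: eqn => K _ HK.
  exists K => // n' /= Kn; have e := HK n'.+1 (leqW Kn).
  rewrite sumEFin; congr _%:E.
  have : lam * \sum_(0 <= k < n') p k.+1 * G (q ^- k.+1 * x) = lam * (r * G x) - (1 - m * x) * g x.
    by rewrite e big_add1/= -/(G x) mulrBr opprB addrCA subrr addr0.
  move=> /(canRL (mulKf (lt0r_neq0 lam_gt0))) ->.
  by field; rewrite gt_eqF.
rewrite -!EFinM -!EFinD; congr _%:E; rewrite -/g; field.
by rewrite gt_eqF.
Qed.

End glued_moments.

(** * The law of the jumps, and the density *)

Section jump_law.
Context (R : realType) (d : measure_display) (T : measurableType d).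
Context (P : probability T R) (Z : nat -> {RV P >-> nat}).
Hypothesis Z_iid : iid P (fun i => Z i : T -> nat).

Let p k := fine (P [set w | Z 0%N w = k]).

Lemma jump_prob_ge0 k : 0 <= p k.
Proof. exact: fine_ge0. Qed.

Lemma jump_pgf_tail (x : R) : 0 <= x <= 1 ->
  (\sum_(k <oo) (p k.+1 * x ^+ k.+1)%:E = (jump_pgf Z x - p 0)%:E)%E.
Proof.
move=> x01; have px k : (0 <= (p k * x ^+ k)%:E)%E.
  by rewrite lee_fin mulr_ge0 ?jump_prob_ge0// exprn_ge0//; case/andP: x01.
have := jump_pgf_series Z_iid x01.
rewrite (nneseriesS px) expr0 mulr1 EFinB => ->.
by rewrite addeAC subee ?add0e.
Qed.

(** The total mass of the positive values is the case [x = 1] of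
    [jump_pgf_tail]. *)
Lemma jump_prob_sum n : \sum_(1 <= k < n) p k <= fine (P [set w | (1 <= Z 0%N w)%N]).
Proof.
have pgf1 : jump_pgf Z 1 <= 1.
  by have /andP[] := jump_pgf01 Z_iid (introT andP (conj ler01 (lexx (1 : R)))).
rewrite prob_ge1 -/(p 0).
apply: (@le_trans _ _ (jump_pgf Z 1 - p 0)); last by rewrite lerD2r.
rewrite -lee_fin -(@jump_pgf_tail 1) ?ler01 ?lexx//.
case: n => [|n].
  rewrite big_geq//; apply: nneseries_ge0 => k _ _.
  by rewrite lee_fin expr1n mulr1 jump_prob_ge0.
rewrite big_add1/= -sumEFin.
under eq_eseriesr do rewrite expr1n mulr1.
by apply: nneseries_lim_ge => k _ _; rewrite lee_fin jump_prob_ge0.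
Qed.

End jump_law.

Theorem theorem3p8 (R : realType) (d : measure_display) (T : measurableType d)
    (P : probability T R) (lam : R) (N : R -> {RV P >-> nat})
    (Z : nat -> {RV P >-> nat}) (q mu : R)
    (lam_gt0 : 0 < lam)
    (N_poisson : poisson_process P lam (fun t => N t : T -> nat))
    (Z_iid : iid P (fun i => Z i : T -> nat))
    (NZ_indep : indep_systems P
       (sigma_family [set t : R | 0 <= t] (fun t => N t : T -> nat))
       (sigma_family [set: nat] (fun i => Z i : T -> nat)))
    (Z_ge1 : (0 < P [set w | (1 <= Z 0%N w)%N])%E)
    (q01 : 0 < q < 1) (mu_gt0 : 0 < mu) :
  let S := compound (fun t => N t : T -> nat) (fun i => Z i : T -> nat) in
  let muq := - ln q * mu in
  let p := fun k : nat => fine (P [set w | Z 0%N w = k]) in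
  let r := fine (P [set w | (1 <= Z 0%N w)%N]) in
  (exists h : nat -> R -> R, h_recurrence q muq lam r p h) /\
  (forall h : nat -> R -> R, h_recurrence q muq lam r p h ->
    [/\ h_convergent q muq lam r h,
        0 < norm_const q muq h
      & has_density P (exp_functional q mu S) (phi q muq h)]).
Proof.
move=> S muq p r; split; first exact: h_recurrence_exists.
have r_gt0 : 0 < r.
  rewrite -lte_fin fineK// fin_num_measure//.
  exact: (@RV_preimage_measurable _ _ _ P (Z 0) [set k | (1 <= k)%N]).
have m_gt0 : 0 < muq := muq_gt0 q01 mu_gt0.
have p_ge0 : forall k, 0 <= p k := jump_prob_ge0 Z.
have p_sum : forall n, \sum_(1 <= k < n) p k <= r := jump_prob_sum Z_iid.
move=> h hrec; pose C := norm_const q muq h; pose g := glued q muq h.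
have C_gt0 : 0 < C := norm_const_gt0 q01 m_gt0 lam_gt0 r_gt0 hrec p_ge0 p_sum.
have g_ge0 x : 0 <= g x := glued_ge0 q01 m_gt0 lam_gt0 r_gt0 hrec p_ge0 p_sum x.
have phi_ge0 x : 0 <= phi q muq h x.
  by rewrite -[phi _ _ _ _]/(C^-1 * g x) mulr_ge0 ?invr_ge0 ?(ltW C_gt0).
have mg : measurable_fun setT g := glued_measurable q01 m_gt0 lam_gt0 r_gt0 hrec.
have mphi : measurable_fun setT (phi q muq h) by exact: measurable_funM.
have intg : (\int[lebesgue_measure]_x (g x)%:E = C%:E)%E.
  exact: (integral_glued q01 m_gt0 lam_gt0 r_gt0 hrec p_ge0 p_sum).
split=> //.
  split.
  - by move=> j k x kj _; exact: (h_integrand_integrable q01 m_gt0 lam_gt0 r_gt0 hrec).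
  - by move=> j; exact: (h_integrable q01 m_gt0 lam_gt0 r_gt0 hrec).
  - exact: (norm_terms_cvg q01 m_gt0 lam_gt0 r_gt0 hrec p_ge0 p_sum).
have mI := exp_functional_measurable Z N_poisson q01 mu_gt0.
split=> // A mA.
have bnd := exp_functional_bounds Z N_poisson q01 mu_gt0.
have momentsE n : moment g n = C * (n`!%:R * \prod_(i < n) (laplace_exponent lam Z q mu i.+1)^-1).
  elim: n => [|n IH].
    rewrite big_ord0 mulr1 mulr1 /moment.
    by under eq_integral do rewrite expr0 mul1r; rewrite intg.
  have qn01 : 0 <= q ^+ n.+1 <= 1.
    by case/andP: q01 => /ltW q0 /ltW q1; rewrite exprn_ge0// exprn_ile1.
  have sE := jump_pgf_tail Z_iid qn01.
  have {}sE : (\sum_(k <oo) (p k.+1 * (q ^+ k.+1) ^+ n.+1)%:E = (jump_pgf Z (q ^+ n.+1) - p 0)%:E)%E.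
    by rewrite -sE; apply: eq_eseriesr => k _; rewrite exprAC.
  have := glued_moment_recursion q01 m_gt0 lam_gt0 r_gt0 hrec p_ge0 p_sum sE.
  have -> : n.+1%:R * muq + lam * (r - (jump_pgf Z (q ^+ n.+1) - p 0)) =
      laplace_exponent lam Z q mu n.+1.
    by rewrite /laplace_exponent /r prob_ge1 -/(p 0) opprB addrA subrK.
  have L0 : laplace_exponent lam Z q mu n.+1 != 0.
    by rewrite gt_eqF// laplace_exponent_gt0.
  move=> e; apply: (mulfI L0); rewrite -e IH big_ord_recr/= factS natrM.
  by field.
(* [density_of_moments] wants a half-open interval, and the functional may reach
   [muq^-1] (on a path without positive jumps), hence the wider support *)
apply: (@density_of_moments _ _ _ P _ (phi q muq h) (2 / muq)) => //.
- move=> w; have /andP[-> Ib] := bnd w; rewrite (le_lt_trans Ib)//.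
  by rewrite ltr_pMl ?invr_gt0// ltr1n.
- move=> x xN; rewrite /phi -/(glued q muq h x) (glued_eq0 h q01 m_gt0) ?mulr0//.
  apply: contra xN => /andP[x0]; rewrite expr0 mul1r => xb.
  by rewrite ltW// (le_lt_trans xb)// ltr_pMl ?invr_gt0// ltr1n.
move=> n; rewrite (exp_functional_moment lam_gt0 N_poisson Z_iid NZ_indep q01 mu_gt0).
transitivity (\int[lebesgue_measure]_x ((C^-1)%:E * (x ^+ n * g x)%:E))%E; last first.
  by apply: eq_integral => x _; rewrite -EFinM mulrCA.
rewrite ge0_integralZl//.
- rewrite (@momentE _ g mg g_ge0 (q ^+ 0 / muq)).
  + by rewrite momentsE -EFinM mulKf// gt_eqF.
  + by rewrite expr0 mul1r invr_gt0.
  + by move=> x; exact: (glued_eq0 h q01 m_gt0).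
  + by rewrite intg ltry.
- apply/measurable_EFinP; apply: measurable_funM => //.
- move=> x _; rewrite lee_fin; have [/andP[x0 _]|xN] := boolP (0 < x <= q ^+ 0 / muq).
    by rewrite mulr_ge0// exprn_ge0// ltW.
  by rewrite /g (glued_eq0 h q01 m_gt0) ?mulr0.
- by rewrite lee_fin invr_ge0 ltW.
Qed.
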